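(* Let $N\ge 1$, $\alpha_1,\dots,\alpha_N\in\{0,1\}$, $R(z)=\exp(r(z))\in \mathrm{Id}+z\,\mathrm{End}(\mathbb C^N)[[z]]$, $T(z)=\sum_{j\ge1}\sum_a\Delta T^a_j z^j\tilde e_a\in z\mathbb C^N[[z]]$ with $\Delta T_1^a=0$ whenever $\alpha_a=1$, and $\Delta=(\Delta_1,\dots,\Delta_N)\in\mathbb C^N$ (with fixed square roots). Let $Z=\widehat R\,\widehat T\,\widehat\Delta\cdot\prod_{a=1}^N\tau_{\alpha_a}(\hbar,\mathbf T^a)$ be the associated generalized ancestor potential and $\widehat W=\widehat R\,\widehat V\,\widehat W_\Delta\,\widehat V^{-1}\widehat R^{-1}$ the associated cut-and-join operator (defined in the context). Write $Z=\sum_{k\ge0}Z^{(k)}\hbar^k$ with $Z^{(k)}\in\mathbb C[\mathbf T]$. Then $Z^{(0)}=1$ and $$Z^{(k)}=\frac1k\,\widehat W\cdot Z^{(k-1)}\qquad\text{for all }k\ge1.$$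
   Context: Notation. $(2k-1)!!=1\cdot3\cdots(2k-1)$, $(-1)!!=1$. $\mathbb C^N$ has orthonormal basis $\tilde e_1,\dots,\tilde e_N$. Formal variables $\mathbf T=\{T^a_k\}_{1\le a\le N,\,k\ge0}$, $\mathbf T^a=\{T^a_k\}_{k\ge0}$; $T_k^a$ and $\partial/\partial T_k^a$ are $0$ for $k<0$. Operators are (formal completions of) differential operators acting on $\mathbb C[\mathbf T][[\hbar]]$. Virasoro operators in one family $\{T_k\}_{k\ge 0}$: $$\widehat L_m=\tfrac12\sum_{i+j=-m-1}\frac{T_iT_j}{(2i-1)!!(2j-1)!!}+\sum_{k\ge0}\frac{(2k+2m+1)!!}{(2k-1)!!}T_k\frac{\partial}{\partial T_{k+m}}+\tfrac12\sum_{i+j=m-1}(2i+1)!!(2j+1)!!\frac{\partial^2}{\partial T_i\partial T_j};$$ $\widehat L_m(\mathbf T^a)$ is this operator in the variables $\mathbf T^a$. Tau-functions. $\tau_1$ is the Kontsevich--Witten tau-function $\tau_1(\hbar,\mathbf T)=\exp\big(\sum_{2g-2+n>0}\frac{\hbar^{2g-2+n}}{n!}\sum_{k_1,\dots,k_n\ge0}\int_{\overline{\mathcal M}_{g,n}}\psi_1^{k_1}\cdots\psi_n^{k_n}\,T_{k_1}\cdots T_{k_n}\big)$; $\tau_0$ is the Brézin--Gross--Witten tau-function, given by the same formula with Norbury's class $\Theta_{g,n}\in H^{4g-4+2n}(\overline{\mathcal M}_{g,n})$ inserted in the integral. Equivalently (known), $\tau_\alpha$ is the unique element of $\mathbb C[\mathbf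 T][[\hbar]]$ with $\tau_\alpha|_{\mathbf T=0}=1$ and $\big(\tfrac12\widehat L_k-\frac{(2k+2\alpha+1)!!}{2\hbar}\frac{\partial}{\partial T_{k+\alpha}}+\frac{\delta_{k,0}}{16}\big)\tau_\alpha=0$ for all $k\ge-\alpha$. Operators. Write $r(z)=\sum_{k\ge1}r_kz^k$, $r_k\tilde e_a=\sum_b(r_k)^b_a\tilde e_b$, $(r_k)^{ab}=(r_k)_a^b$. Then $$\widehat R=\exp\Big(\sum_{k\ge1}\sum_{a,b}\Big(\sum_{j\ge0}(r_k)^b_aT^a_j\frac{\partial}{\partial T^b_{k+j}}+\tfrac12\sum_{j=0}^{k-1}(-1)^{j+1}(r_k)^{ab}\frac{\partial^2}{\partial T^a_j\partial T^b_{k-j-1}}\Big)\Big),$$ $$\widehat T=\exp\Big(\frac1\hbar\sum_{k\ge1}\sum_a\Delta T^a_k\frac{\partial}{\partial T^a_k}\Big),\qquad \widehat\Delta\cdot\prod_a\tau_{\alpha_a}(\hbar,\mathbf T^a)=\prod_a\tau_{\alpha_a}(\hbar\sqrt{\Delta_a},\mathbf T^a).$$ No symplectic condition on $R$ is assumed. Virasoro group element. For each $a$ let $v^a(z)=\sqrt{\Delta_a}\sum_{k\ge1+\alpha_a}\frac{\Delta T^a_k}{(2k+1)!!}z^{2k+1}$ and $f^a(z)=z\big(1-(2\alpha_a+1)v^a(z)/z^{2\alpha_a+1}\big)^{1/(2\alpha_a+1)}\in z+z^3\mathbb C[[z^2]]$. Let $\chi^a_k$ ($k\ge1$) be the unique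 constants with $f^a(z)=\exp\big(-\sum_{k\ge1}\chi_k^az^{2k+1}\frac{\partial}{\partial z}\big)\cdot z$. Then $\widehat V=\prod_{a=1}^N\exp\big(\sum_{k\ge1}\chi^a_k\widehat L_k(\mathbf T^a)\big)$. Initial cut-and-join operator: $$\widehat W_\Delta=\sum_{a=1}^N\frac{\sqrt{\Delta_a}}{2\alpha_a+1}\sum_{k\ge0}\frac{T^a_k}{(2k-1)!!}\Big(\widehat L_{k-\alpha_a}(\mathbf T^a)+\frac{\delta_{k,\alpha_a}}8\Big).$$ *)

(* Defs.v *)
From mathcomp Require Import mathcomp_extra boolp classical_sets functions.
From mathcomp Require Import cardinality fsbigop.
From mathcomp Require Export all_boot all_order all_algebra.
From mathcomp Require Export finmap reals complex monalg.

Set Implicit Arguments.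
Unset Strict Implicit.
Unset Printing Implicit Defensive.

Import GRing.Theory.

Local Open Scope classical_set_scope.
Local Open Scope ring_scope.

(* Infinite sums are the finitely supported sums \sum_(i \in A) F i of fsbigop
   (0 when the support is infinite).  On polynomials their support is finite,
   because a polynomial involves finitely many variables and the exponentiated
   operators are locally nilpotent.  In T_hat, which involves hbar^-1, it is
   finite at each power of hbar for products of the tau-functions below, when
   DT a 1 = 0 whenever alpha a = 1. *)

(* n!!; since 0.-1 = 0, the value (-1)!! = 1 is obtained as dfact (0.*2.-1). *)
Fixpoint dfact (n : nat) : nat :=
  if n is m.+2 then (n * dfact m)%N else 1%N.

(* A formal power series over A is its sequence of coefficients nat -> A. *)
Section PowerSeries.
Context {A : pzSemiRingType}.
Implicit Types f g : nat -> A.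

Definition ps_one : nat -> A := fun n => (n == 0)%:R.
Definition ps_mul f g : nat -> A := fun n => \sum_(i < n.+1) f i * g (n - i)%N.
Definition ps_exp f (j : nat) : nat -> A := iter j (ps_mul f) ps_one.
End PowerSeries.

(* exp(r(z)), for r with zero constant term: r^j has order at least j. *)
Definition ps_expo (C : fieldType) (N : nat) (r : nat -> 'M[C]_N) :
    nat -> 'M[C]_N :=
  fun n => \sum_(j < n.+1) (j`!%:R)^-1 *: ps_exp r j n.

(* Binomial series (1 + x(z))^q, for x with zero constant term. *)
Definition ps_pow1p (C : fieldType) (q : C) (x : nat -> C) : nat -> C :=
  fun n => \sum_(j < n.+1)
    (\prod_(i < j) (q - i%:R)) / j`!%:R * ps_exp x j n.

(* exp(- \sum_(k >= 1) chi_k z^(2k+1) d/dz) . z, where the coefficient of z^n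
   in z^(2k+1) h'(z) is (n - 2k) h_(n-2k).  Each application of the vector
   field raises the order in z by at least 2. *)
Definition odd_vf (C : fieldType) (chi : nat -> C) (h : nat -> C) : nat -> C :=
  fun n => \sum_(1 <= k < n.+1 | (k.*2 <= n)%N)
    chi k * (n - k.*2)%:R * h (n - k.*2)%N.

Definition odd_flow (C : fieldType) (chi : nat -> C) : nat -> C :=
  fun n => \sum_(j < n.+1)
    (j`!%:R)^-1 * iter j (odd_vf (fun k => - chi k)) (fun i => (i == 1)%:R) n.

(* v(z) = s \sum_(k >= 1 + al) DT_k / (2k+1)!! z^(2k+1) *)
Definition v_series (C : fieldType) (al : nat) (s : C) (DT : nat -> C) :
    nat -> C :=
  fun n => if odd n && (al.*2.+3 <= n)%N then s * DT n./2 / (dfact n)%:R else 0.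

(* f(z) = z (1 - (2 al + 1) v(z) / z^(2 al + 1))^(1 / (2 al + 1)) *)
Definition f_series (C : fieldType) (al : nat) (s : C) (DT : nat -> C) :
    nat -> C :=
  fun n => if n is m.+1 then
    ps_pow1p (al.*2.+1%:R)^-1
      (fun i => - (al.*2.+1%:R * v_series al s DT (i + al.*2.+1)%N)) m
  else 0.

(* C[T_i : i in I], for an arbitrary (possibly infinite) set of variables *)
Notation polyring C I := {malg C[{cmonom I}]}.

Section Operators.
Context {C : fieldType}.

Section AnyVariables.
Context {I : choiceType}.
Implicit Types (p : polyring C I) (i : I).

Definition pvar i : polyring C I := << (@ucm I i) >>.

Definition pderiv i p : polyring C I :=
  \sum_(m <- msupp p) << (p@_m *+ cmonom_val m i) *g divcm m (@ucm I i) >>.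

Definition op_exp (A : polyring C I -> polyring C I) p : polyring C I :=
  \sum_(j \in [set: nat]) (j`!%:R)^-1 *: iter j A p.

(* \hat L_m in the family of variables T_k = pvar (x k) *)
Definition virasoro (x : nat -> I) (m : int) p : polyring C I :=
    2^-1 *: (if m is Negz n then
               \sum_(i < n.+1) ((dfact i.*2.-1 * dfact (n - i).*2.-1)%:R)^-1 *:
                 (pvar (x i) * pvar (x (n - i)%N) * p)
             else 0)
  + \sum_(k \in [set: nat])
      (if k%:Z + m is Posz l then
         ((dfact l.*2.+1)%:R / (dfact k.*2.-1)%:R) *:
           (pvar (x k) * pderiv (x l) p)
       else 0)
  + 2^-1 *: (if m is Posz n then
               \sum_(i < n) (dfact i.*2.+1 * dfact (n - i.+1).*2.+1)%:R *:
                 pderiv (x i) (pderiv (x (n - i.+1)%N) p)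
             else 0).

End AnyVariables.

(* Formal Laurent families \sum_(m in Z) F_m hbar^m with polynomial
   coefficients; C[T][[hbar]] is embedded by to_laurent. *)
Definition to_laurent {I : choiceType} (F : nat -> polyring C I) :
    int -> polyring C I :=
  fun m => if m is Posz n then F n else 0.

(* The Kontsevich-Witten (al = 1) and Brezin-Gross-Witten (al = 0)
   tau-functions, through their characterisation as the unique normalised
   solution of the Virasoro constraints; the operator of index k >= - al is
   written with l = k + al. *)
Definition is_tau (al : nat) (tau : nat -> polyring C nat) : Prop :=
  (forall n, (tau n)@_(@onecm nat) = (n == 0)%:R) /\
  (forall (l : nat) (m : int),
      2^-1 *: virasoro id (l%:Z - al%:Z) (to_laurent tau m)
    - ((dfact l.*2.+1)%:R / 2) *: pderiv l (to_laurent tau (m + 1))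
    + ((l == al)%:R / 16) *: to_laurent tau m = 0).

Section Families.
Context {N : nat}.

(* T^a_k is the variable (a, k). *)
Notation P := (polyring C ('I_N * nat)%type).

Definition in_family (a : 'I_N) (p : polyring C nat) : P :=
  \sum_(m <- msupp p) p@_m *:
    \prod_(k <- finsupp (cmonom_val m)) pvar (a, k) ^+ cmonom_val m k.

(* \hat Delta . \prod_a tau_(alpha_a)(hbar, T^a), with sqD a = sqrt(Delta_a) *)
Definition Delta_tau (alpha : 'I_N -> 'I_2) (sqD : 'I_N -> C)
    (tau : 'I_2 -> nat -> polyring C nat) : nat -> P :=
  \big[ps_mul/ps_one]_(a < N)
    (fun n => sqD a ^+ n *: in_family a (tau (alpha a) n)).

Definition T_exponent (DT : 'I_N -> nat -> C) (F : int -> P) : int -> P :=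
  fun m => \sum_(k \in [set k : nat | (0 < k)%N]) \sum_(a < N)
    DT a k *: pderiv (a, k) (F (m + 1)).

Definition T_hat (DT : 'I_N -> nat -> C) (F : int -> P) : int -> P :=
  fun m => \sum_(j \in [set: nat]) (j`!%:R)^-1 *: iter j (T_exponent DT) F m.

(* r k acts on column vectors: (r_k)_a^b = (r_k)^{ab} = r k b a. *)
Definition R_exponent (r : nat -> 'M[C]_N) (p : P) : P :=
  \sum_(k \in [set k : nat | (0 < k)%N]) \sum_(a < N) \sum_(b < N)
    (\sum_(j \in [set: nat])
        r k b a *: (pvar (a, j) * pderiv (b, (k + j)%N) p)
     + 2^-1 *: \sum_(j < k) ((-1) ^+ j.+1 * r k b a) *:
         pderiv (a, (j : nat)) (pderiv (b, (k - j - 1)%N) p)).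

Definition R_hat (r : nat -> 'M[C]_N) : P -> P := op_exp (R_exponent r).

Definition V_hat (chi : 'I_N -> nat -> C) : P -> P :=
  \big[comp/id]_(a < N) op_exp (fun p : P =>
    \sum_(k \in [set k : nat | (0 < k)%N])
      chi a k *: virasoro (fun i => (a, i)) k%:Z p).

Definition W_Delta (alpha : 'I_N -> 'I_2) (sqD : 'I_N -> C) (p : P) : P :=
  \sum_(a < N) (sqD a / (alpha a).*2.+1%:R) *:
    \sum_(k \in [set: nat]) ((dfact k.*2.-1)%:R)^-1 *:
      (pvar (a, k) * (virasoro (fun i => (a, i)) (k%:Z - (alpha a)%:Z) p
                      + ((k == alpha a)%:R / 8) *: p)).

Definition ancestor (alpha : 'I_N -> 'I_2) (r : nat -> 'M[C]_N)
    (DT : 'I_N -> nat -> C) (sqD : 'I_N -> C)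
    (tau : 'I_2 -> nat -> polyring C nat) : int -> P :=
  fun m => R_hat r (T_hat DT (to_laurent (Delta_tau alpha sqD tau)) m).

(* The inverses are exp(A)^-1 = exp(- A); the factors of V_hat commute. *)
Definition cut_and_join (alpha : 'I_N -> 'I_2) (r : nat -> 'M[C]_N)
    (sqD : 'I_N -> C) (chi : 'I_N -> nat -> C) : P -> P :=
  R_hat r \o V_hat chi \o W_Delta alpha sqD
    \o V_hat (fun a k => - chi a k) \o R_hat (fun k => - r k).

End Families.
End Operators.

(* Main.v *)
(* The tau-functions satisfy the Virasoro constraints, so the coefficients Z_n of
   their rescaled product satisfy
     sqrt(Delta_a) (L_(l-alpha_a)(T^a) + delta/8) Z_n = (2l+1)!! d/dT^a_l Z_(n+1).
   By induction on n, Z_n is homogeneous of weight n when T^a_l has weight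
   (2l+1)/(2alpha_a+1); summing the constraints against T^a_l therefore produces
   the Euler operator, and W_Delta Z_n = (n+1) Z_(n+1).

   To replace the translation by the Virasoro group element, put X = \sum chi L
   and, for a family y of constants, Y_y = hbar^-1 \sum y^a_k d/dT^a_k.  Then
   [X, Y_y] = Y_(A y), where A is the vector field
   - \sum chi_k z^(2k+1) d/dz acting on y through z^(2k+1)/(2k+1)!!, and the
   constraints say X Z = Y_c Z.  Hence exp(t X) Z = exp(Y_y(t)) Z, where y(t)
   solves y' = c + A y, that is y(t) = \sum_(i >= 1) t^i A^(i-1) c / i!.  As c is
   a multiple of A z^(2alpha+1), y(1) is a multiple of f(z)^(2alpha+1) -
   z^(2alpha+1), and this is the translation defined by v(z).

   The recursion for Z_n is then conjugated by the invertible operators V and R. *)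
From HB Require Import structures.
Require Import Defs.
From mathcomp Require Import boolp classical_sets functions fsbigop.
From mathcomp Require Import zify ring.

Set Implicit Arguments.
Unset Strict Implicit.
Unset Printing Implicit Defensive.

Import Order.TTheory GRing.Theory Num.Theory.
Local Open Scope ring_scope.

(** * Linear maps and locally finite sums *)

(** The obstacle is finiteness. Virasoro operators of positive index lower the weight of a
    polynomial, so [exp X] is a finite sum on each polynomial; the translation carries hbar^-1 and
    infinitely many derivatives, and is finite only on families graded like Z. To stay in the
    integers, weights are tripled: T^a_l has weight b_a (2l+1) with b_a (2 alpha_a + 1) = 3, so Z_m
    has weight 3m. The coefficient of t^(i+1) in y(t) involves only T^a_l with l >= alpha_a + i + 1.
    Passing from hbar^(m+1) to hbar^m accounts for a loss of 3, while such a derivative loses at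
    least 3 + 2(i+1). At each power of hbar both exponentials are therefore polynomials in t, and t
    = 1 can be substituted. A second weight, 2l+1 in every family, serves the R-action: R mixes the
    families and need not lower a weight that depends on a. When sqrt(Delta_a) = 0 the constraints
    cannot be divided by it; then no variable of the family a occurs in Z, and the translation of
    that family is inert. *)

Section LinearMaps.
Context {C : pzRingType} {U V : lmodType C} {f : U -> V} (f_lin : linear f).

(** Linearity of the locally finite operators below is a proposition proved from weights, not a
    structure; packing it here gives access to the general theory of linear maps. *)
Let fl : {linear U -> V} := HB.pack f (GRing.isLinear.Build C U V *:%R f f_lin).

Lemma lin0 : f 0 = 0. Proof. exact: (raddf0 fl). Qed.
Lemma linD u v : f (u + v) = f u + f v. Proof. exact: (raddfD fl). Qed.
Lemma linN u : f (- u) = - f u. Proof. exact: (raddfN fl). Qed.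
Lemma linMn n u : f (u *+ n) = f u *+ n. Proof. exact: (raddfMn fl). Qed.
Lemma linZ c u : f (c *: u) = c *: f u. Proof. exact: (linearZ_LR fl). Qed.
Lemma lin_sum (J : Type) (s : seq J) (Q : pred J) (F : J -> U) :
  f (\sum_(j <- s | Q j) F j) = \sum_(j <- s | Q j) f (F j).
Proof. exact: (raddf_sum fl). Qed.
End LinearMaps.

Section LocallyFiniteSums.

Lemma fsum_nat (V : zmodType) (D : set nat) (F : nat -> V) (K : nat) :
  (forall k, (K <= k)%N -> F k = 0) ->
  \sum_(k \in D) F k = \sum_(k < K | (k : nat) \in D) F k.
Proof.
move=> F0; rewrite fsbig_mkcond (@fsbigE _ _ _ _ _ (iota 0 K)) ?iota_uniq//; last first.
  move=> k _; rewrite mem_iota add0n/= -leqNgt => /F0.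
  by rewrite /patch; case: ifP.
rewrite -[K in iota 0 K]subn0 -/(index_iota 0 K).
rewrite -(big_mkord (fun k => k \in D)) big_mkcond [RHS]big_mkcond/=.
by apply: eq_big_nat => k _; rewrite in_setT.
Qed.

Lemma fsum_setT (V : zmodType) (F : nat -> V) (K : nat) :
  (forall k, (K <= k)%N -> F k = 0) ->
  \sum_(k \in [set: nat]%classic) F k = \sum_(k < K) F k.
Proof. by move/fsum_nat->; apply: eq_bigl => k; rewrite in_setT. Qed.

Lemma fsum_pos (V : zmodType) (F : nat -> V) (K : nat) :
  (forall k, (K < k)%N -> F k = 0) ->
  \sum_(k \in [set k : nat | (0 < k)%N]%classic) F k = \sum_(k < K) F k.+1.
Proof.
move/(@fsum_nat _ _ _ K.+1)->; rewrite big_mkcond big_ord_recl/=.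
rewrite memNset ?add0r//; apply: eq_bigr => k _.
by rewrite mem_set.
Qed.

Lemma fsum_map (U V : zmodType) (f : U -> V) (D : set nat) (F : nat -> U)
    (K : nat) :
  (forall (s : seq 'I_K) (Q : pred 'I_K) (G : 'I_K -> U),
     f (\sum_(j <- s | Q j) G j) = \sum_(j <- s | Q j) f (G j)) ->
  (forall k, (K <= k)%N -> F k = 0) ->
  f (\sum_(k \in D) F k) = \sum_(k \in D) f (F k).
Proof.
move=> fD F0; have f0 : f 0 = 0 by have := fD [::] xpredT 0; rewrite !big_nil.
by rewrite !(@fsum_nat _ _ _ K) ?fD // => k /F0 ->.
Qed.

Lemma fsum_linear (C : pzRingType) (U V : lmodType C) (D : set nat)
    (F : nat -> U -> V) :
  (forall k, linear (F k)) ->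
  (forall u, exists K, forall k, (K <= k)%N -> F k u = 0) ->
  linear (fun u => \sum_(k \in D) F k u).
Proof.
move=> Fl F0 c u v; have [K1 h1] := F0 u; have [K2 h2] := F0 v.
have h k : (maxn K1 K2 <= k)%N -> F k u = 0 /\ F k v = 0.
  by rewrite geq_max => /andP[/h1 -> /h2 ->].
rewrite (@fsum_nat _ _ (fun k => F k u) (maxn K1 K2)); last by move=> k /h[].
rewrite (@fsum_nat _ _ (fun k => F k v) (maxn K1 K2)); last by move=> k /h[].
rewrite (@fsum_nat _ _ _ (maxn K1 K2)); last first.
  by move=> k /h[e1 e2]; rewrite Fl e1 e2 scaler0 addr0.
rewrite scaler_sumr -big_split/=; apply: eq_bigr => k _; exact: Fl.
Qed.
End LocallyFiniteSums.

Section CauchySums.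
Context {V : zmodType}.
Implicit Types G : nat -> nat -> V.

(** Terms beyond the antidiagonal vanish, so the square can be summed along antidiagonals: the
    finite form of multiplying two exponentials. *)
Lemma triangle_sum G K : (forall i j, (K <= i + j)%N -> G i j = 0) ->
  \sum_(i < K) \sum_(j < K) G i j = \sum_(n < K) \sum_(i < n.+1) G i (n - i)%N.
Proof.
move=> G0.
transitivity (\sum_(i < K) \sum_(n < K | (i <= n)%N) G i (n - i)%N).
  apply: eq_bigr => i _.
  rewrite -(big_mkord xpredT (G i)).
  rewrite -(big_mkord (fun n => (i <= n)%N) (fun n => G i (n - i)%N)).
  rewrite (@big_cat_nat _ _ _ (K - i)%N) ?leq_subr//= [X in _ + X]big_nat_cond.
  rewrite [X in _ + X]big1 ?addr0; last first.
    move=> j /andP[/andP[Kj _] _]; apply: G0.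
    by rewrite -leq_subLR.
  rewrite [RHS](@big_cat_nat _ _ _ i) ?(ltnW (ltn_ord i))//= [X in _ = X + _]big_nat_cond.
  rewrite [X in _ = X + _]big1 ?add0r; last first.
    by move=> j /andP[/andP[_ ji] ij]; rewrite ltnNge ij in ji.
  rewrite -[X in _ = \big[_/_]_(X <= _ < _ | _) _]add0n big_addn.
  rewrite big_nat_cond [RHS]big_nat_cond.
  by apply: eq_big => j; rewrite ?leq_addl ?andbT // addnK.
rewrite (exchange_big_dep xpredT)//=; apply: eq_bigr => n _.
rewrite -(big_mkord (fun i => (i <= n)%N) (fun i => G i (n - i)%N)).
rewrite (@big_cat_nat _ _ _ n.+1)//= [X in _ + X]big_nat_cond.
rewrite [X in _ + X]big1 ?addr0; last first.
  by move=> j /andP[/andP[nj _] jn]; rewrite ltnNge jn in nj.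
rewrite -[RHS](big_mkord xpredT (fun i => G i (n - i)%N)) big_nat_cond.
by rewrite [RHS]big_nat_cond; apply: eq_bigl => i; rewrite /= ltnS; case: leqP.
Qed.

(** Writing n + 1 = i + (n + 1 - i) in each term gives the product rule d/dt (f g) = f' g + f g' at
    t^n. *)
Lemma cauchy_succ G n :
  (\sum_(i < n.+2) G i (n.+1 - i)%N) *+ n.+1 =
  \sum_(i < n.+1) G i.+1 (n - i)%N *+ i.+1 +
  \sum_(i < n.+1) G i (n - i).+1 *+ (n - i).+1.
Proof.
rewrite -sumrMnl.
transitivity (\sum_(i < n.+2) (G i (n.+1 - i)%N *+ i +
   G i (n.+1 - i)%N *+ (n.+1 - i))).
  by apply: eq_bigr => i _; rewrite -mulrnDr subnKC// -ltnS.
rewrite big_split/=; congr (_ + _).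
  by rewrite big_ord_recl/= mulr0n add0r; apply: eq_bigr => i _; rewrite subSS.
rewrite big_ord_recr/= subnn mulr0n addr0; apply: eq_bigr => i _.
by rewrite subSn// -ltnS.
Qed.

Lemma sum_antidiag_sym G n :
  \sum_(i < n.+1) G i (n - i)%N = \sum_(i < n.+1) G (n - i)%N i.
Proof.
rewrite (reindex_inj rev_ord_inj)/=; apply: eq_bigr => i _.
by rewrite subSS subKn// -ltnS.
Qed.

(** Both sides run over the triples with i + j + k = n. This is the associativity of Cauchy products
    and the commutation of convolutions. *)
Lemma sum_antidiagA (H : nat -> nat -> nat -> V) n :
  \sum_(i < n.+1) \sum_(j < (n - i).+1) H i j (n - i - j)%N =
  \sum_(j < n.+1) \sum_(i < (n - j).+1) H i j (n - j - i)%N.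
Proof.
have e (F : nat -> nat -> V) (i : 'I_n.+1) : \sum_(j < (n - i).+1) F i j =
    \sum_(j < n.+1 | (i + j <= n)%N) F i j.
  rewrite -(big_mkord (fun j => (i + j <= n)%N) (F i)).
  rewrite -(big_mkord xpredT (F i)).
  rewrite [RHS](@big_cat_nat _ _ _ (n - i).+1) ?ltnS ?leq_subr//=.
  rewrite [X in _ = _ + X]big_nat_cond [X in _ = _ + X]big1 ?addr0; last first.
    by move=> j /andP[/andP[]]; rewrite ltn_subLR ?ltnNge -1?ltnS// => /negbTE->.
  rewrite big_nat_cond [RHS]big_nat_cond; apply: eq_bigl => j.
  rewrite /= ltnS; case: leqP => //=; rewrite leq_subRL; last by rewrite -ltnS.
  by move->.
under eq_bigr do rewrite (e (fun i j => H i j (n - i - j)%N)).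
under [RHS]eq_bigr => j _ do rewrite (e (fun j i => H i j (n - j - i)%N)).
rewrite (exchange_big_dep xpredT)//=; apply: eq_bigr => j _.
by apply: eq_big => [i|i _]; rewrite 1?addnC// -!subnDA addnC.
Qed.
End CauchySums.

(** * Polynomials in infinitely many variables *)

Section Leibniz.
Context {C : fieldType} {A : comAlgType C} {d : A -> A}.
Implicit Types p q : A.

Lemma leibniz_linear c p1 p2 q : linear d ->
  d (p1 * q) = d p1 * q + p1 * d q -> d (p2 * q) = d p2 * q + p2 * d q ->
  d ((c *: p1 + p2) * q) = d (c *: p1 + p2) * q + (c *: p1 + p2) * d q.
Proof.
move=> dL h1 h2; rewrite mulrDl -scalerAl !dL h1 h2 !mulrDl -!scalerAl.
by rewrite scalerDr addrACA.
Qed.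

Lemma leibniz_mulX (x : A) (b : bool) p q :
  d (p * q) = d p * q + p * d q -> (forall r, d (x * r) = r *+ b + x * d r) ->
  d (x * p * q) = d (x * p) * q + x * p * d q.
Proof.
move=> h dx; rewrite -mulrA !dx h mulrDl !mulrDr addrA mulrnAl.
by rewrite !mulrA.
Qed.
End Leibniz.

Section MonomialWeight.
Local Notation "1" := (@mone _) : monom_scope.
Local Notation "x * y" := (mmul x y) : monom_scope.
Context {I : choiceType} (w : I -> nat).
Implicit Types (m : cmonom I) (i : I).

Definition mweight_of m : nat := \sum_(i <- finsupp m) m i * w i.

Lemma mweight_ofEw m (d : {fset I}) : (finsupp m `<=` d)%fset ->
  mweight_of m = (\sum_(i <- d) m i * w i)%N.
Proof.
move=> le; rewrite /mweight_of (big_fset_incl _ le)//=.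
by move=> i _; rewrite -cmE_eq0 => /eqP->.
Qed.

Lemma mweight_of1 : mweight_of 1%M = 0%N.
Proof. by rewrite /mweight_of mdom1 big_seq_fset0. Qed.

Lemma mweight_ofU i : mweight_of (ucm i) = w i.
Proof. by rewrite /mweight_of mdomU big_seq_fset1 cmUU mul1n. Qed.

Lemma mweight_ofM m1 m2 :
  mweight_of (m1 * m2)%M = (mweight_of m1 + mweight_of m2)%N.
Proof.
rewrite (@mweight_ofEw m1 (finsupp m1 `|` finsupp m2)%fset) ?fsubsetUl//.
rewrite (@mweight_ofEw m2 (finsupp m1 `|` finsupp m2)%fset) ?fsubsetUr//.
rewrite (@mweight_ofEw _ (finsupp m1 `|` finsupp m2)%fset) ?mdomD//.
by rewrite -big_split/=; apply: eq_bigr => i _; rewrite cmM mulnDl.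
Qed.
End MonomialWeight.

(* Unification would otherwise unfold the bigop defining pderiv. *)
Fact dpart_key : unit. Proof. exact: tt. Qed.

Section ElementaryOperators.
Local Notation "1" := (@mone _) : monom_scope.
Local Notation "x * y" := (mmul x y) : monom_scope.
Context {C : fieldType} {I : choiceType}.
Implicit Types (p q : polyring C I) (i j : I) (m : cmonom I).

Lemma mulcm_ucm_gt0 m i : (0 < m i)%N -> exists m', m = (m' * ucm i)%M.
Proof.
move=> mi; exists (divcm m (ucm i)); apply/eqP/cmP => j.
rewrite cmM divcmE cmU subnK//; case: eqP => [<-|]//.
Qed.

Lemma mulcmK m i : divcm (m * ucm i)%M (ucm i) = m.
Proof. by apply/eqP/cmP => j; rewrite divcmE cmM addnK. Qed.

Lemma ucm_inj m m' i : (m * ucm i = m' * ucm i)%M -> m = m'.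
Proof. by move=> /(congr1 (fun x => divcm x (ucm i))); rewrite !mulcmK. Qed.

Lemma mcoeff_pvarM_ucm i p m : (pvar i * p)@_(m * ucm i)%M = p@_m.
Proof.
rewrite /pvar mcoeffMl msuppU1 big_seq_fset1.
rewrite [RHS](_ : _ = (\sum_(k <- msupp p) << p@_k *g k >>)@_m); last first.
  by rewrite -monalgE.
rewrite raddf_sum/=; apply: eq_bigr => k _.
rewrite mcoeffU1 eqxx mul1r.
rewrite mcoeffU.
rewrite [(ucm i * k)%M]mulmC.
have -> : ((k * ucm i)%M == (m * ucm i)%M) = (k == m).
  by apply/eqP/eqP => [/ucm_inj|->].
by [].
Qed.

Lemma mcoeff_pvarM0 i p m : m i = 0%N -> (pvar i * p)@_m = 0.
Proof.
move=> mi; rewrite /pvar mcoeffMl msuppU1 big_seq_fset1 big1// => k _.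
case: eqP => [e|]; last by rewrite mulr0n.
by move: mi; rewrite -e cmM cmUU.
Qed.

Lemma mcoeff_pderiv i p m :
  (pderiv i p)@_m = p@_(m * ucm i)%M *+ (m i).+1.
Proof.
rewrite /pderiv raddf_sum/= [p in RHS]monalgE raddf_sum/= -sumrMnl.
apply: eq_bigr => k _; rewrite !mcoeffU.
have [ki|ki] := posnP (k i).
  rewrite ki mulr0n mul0rn; case: eqP => [e|]; last by rewrite mulr0n mul0rn.
  by move: ki; rewrite e cmM cmUU addn1.
have [k' ->] := mulcm_ucm_gt0 ki; rewrite mulcmK cmM cmUU addn1.
case: (eqVneq k' m) => [->|ne]; first by rewrite eqxx.
rewrite mulr0n; case: eqP => [/ucm_inj e|]; last by rewrite mulr0n mul0rn.
by rewrite e eqxx in ne.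
Qed.

Definition dpart i p := locked_with dpart_key (@pderiv C I i) p.

Lemma pderivE i p : pderiv i p = dpart i p.
Proof. by rewrite /dpart unlock. Qed.

Lemma mcoeff_dpart i p m : (dpart i p)@_m = p@_(m * ucm i)%M *+ (m i).+1.
Proof. by rewrite -pderivE mcoeff_pderiv. Qed.

Lemma dpart_linear i : linear (dpart i).
Proof.
move=> c p q; apply/malgP => m.
rewrite mcoeff_dpart mcoeffD mcoeffZ mcoeffD.
rewrite [X in _ = X + _]mcoeffZ.
by rewrite !mcoeff_dpart mulrnDl mulrnAr.
Qed.

Lemma pvarM_linear i : linear ( *%R (pvar i) : polyring C I -> polyring C I).
Proof. by move=> c p q; rewrite mulrDr scalerAr. Qed.

Lemma dpart1 i : dpart i (1 : polyring C I) = 0.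
Proof.
apply/malgP => m; rewrite mcoeff_dpart mcoeff0 mcoeff1.
by case: eqP => [/eqP|]; rewrite ?mul0rn// cmM_eq1 cm1_eq1 andbF.
Qed.

Lemma dpart_pvarM i j p :
  dpart i (pvar j * p) = p *+ (i == j) + pvar j * dpart i p.
Proof.
apply/malgP => m; rewrite mcoeff_dpart mcoeffD mcoeffMn.
have [<-|ne] := eqVneq i j.
  rewrite mcoeff_pvarM_ucm mulr1n; have [mi|mi] := posnP (m i).
    by rewrite mcoeff_pvarM0// addr0 mi.
  have [m' ->] := mulcm_ucm_gt0 mi; rewrite mcoeff_pvarM_ucm mcoeff_dpart.
  by rewrite cmM cmUU addn1 mulrS.
rewrite mulr0n add0r; have [mj|mj] := posnP (m j).
  by rewrite !mcoeff_pvarM0 ?mul0rn// cmM mj cmU (negPf ne).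
have [m' ->] := mulcm_ucm_gt0 mj; rewrite [RHS]mcoeff_pvarM_ucm mcoeff_dpart.
rewrite -mulmA (mulmC (ucm j)) mulmA [X in X *+ _]mcoeff_pvarM_ucm cmM cmU.
by rewrite eq_sym (negPf ne) addn0.
Qed.

(** Induction on the degree reaches every monomial, and linearity every polynomial. Identities
    between derivations and ring morphisms then need checking only at 1 and under multiplication by
    one variable. *)
Lemma polyring_ind (Q : polyring C I -> Prop) :
  Q 1 -> (forall c p q, Q p -> Q q -> Q (c *: p + q)) ->
  (forall i p, Q p -> Q (pvar i * p)) -> forall p, Q p.
Proof.
move=> Q1 Qlin QX p.
have Q0 : Q 0 by have := Qlin (-1) 1 1 Q1 Q1; rewrite scaleN1r addNr.
have Qm m : Q << m >>.
  move: {2}(mdeg m) (erefl (mdeg m)) => n; elim: n m => [|n IH] m e.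
    by rewrite (mdeg_eq0I e).
  have : m != 1%M by rewrite -mdeg_eq0 e.
  have [[i mi] _|h] := EM (exists i, (0 < m i)%N).
    have [m' em] := mulcm_ucm_gt0 mi.
    have -> : << m >> = pvar i * << m' >> :> polyring C I.
      by rewrite em mulmC malgM_def fgmulUU mulr1.
    apply/QX/IH/eqP; rewrite -(eqn_add2r 1) [X in _ == X]addn1 -e em.
    by rewrite mdegM mdegU.
  case/negP; apply/eqP/eqP/cmP => i; rewrite cm1.
  by apply/eqP; rewrite -leqn0 leqNgt; apply/negP => mi; apply: h; exists i.
rewrite [p]monalgE; elim: (msupp p : seq _) => [|m s IH]; rewrite ?big_nil//.
rewrite big_cons; have -> : << p@_m *g m >> = p@_m *: << m >> :> polyring C I.
  apply/malgP => k.
  by rewrite [RHS]mcoeffZ [LHS]mcoeffU [X in _ * X]mcoeffU mulr_natr.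
exact: (Qlin _ _ _ (Qm m) IH).
Qed.

Lemma dpartM i p q : dpart i (p * q) = dpart i p * q + p * dpart i q.
Proof.
elim/polyring_ind: p => [|c p1 p2 h1 h2|j p h].
- by rewrite dpart1 mul0r add0r !mul1r.
- exact: (leibniz_linear c (dpart_linear i) h1 h2).
- exact: (leibniz_mulX h (dpart_pvarM i j)).
Qed.

Lemma dpartC i j p : dpart i (dpart j p) = dpart j (dpart i p).
Proof.
apply/malgP => m; rewrite [LHS]mcoeff_dpart [X in X *+ _]mcoeff_dpart.
rewrite [RHS]mcoeff_dpart [X in _ = X *+ _]mcoeff_dpart !cmM !cmU -!mulrnA.
rewrite -(mulmA m (ucm i)) (mulmC (ucm i) (ucm j)) (mulmA m (ucm j)).
rewrite [j == i]eq_sym; congr (_ *+ _).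
by case: eqP => [->|_]//; rewrite !addn0 mulnC.
Qed.

Lemma mcoeff1_pvarM i p : (pvar i * p)@_1%M = 0.
Proof. by rewrite mcoeff_pvarM0// cm1. Qed.

Lemma mcoeff_pvar_dpart i p m : (pvar i * dpart i p)@_m = p@_m *+ m i.
Proof.
have [mi|mi] := posnP (m i); first by rewrite mcoeff_pvarM0// mi.
have [m' ->] := mulcm_ucm_gt0 mi.
by rewrite mcoeff_pvarM_ucm mcoeff_dpart cmM cmUU addn1.
Qed.
End ElementaryOperators.

Section WeightSupport.
Local Notation "1" := (@mone _) : monom_scope.
Local Notation "x * y" := (mmul x y) : monom_scope.
Context {C : fieldType} {I : choiceType} (w : I -> nat).
Implicit Types (p q : polyring C I) (i : I) (Q : int -> Prop).

(** A predicate on weights covers at once homogeneity (z = d) and the filtration (z <= d). Weights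
    live in [int] because derivatives subtract them without truncation. *)
Definition weight_in Q p := forall m, p@_m != 0 -> Q (mweight_of w m)%:Z.

Lemma weight_in0 Q : weight_in Q 0.
Proof. by move=> m; rewrite mcoeff0 eqxx. Qed.

Lemma weight_inD Q p q : weight_in Q p -> weight_in Q q -> weight_in Q (p + q).
Proof.
move=> hp hq m; rewrite mcoeffD.
by case: (eqVneq p@_m 0) => [->|/hp//]; rewrite add0r; exact: hq.
Qed.

Lemma weight_inZ Q c p : weight_in Q p -> weight_in Q (c *: p).
Proof. by move=> hp m; rewrite mcoeffZ mulf_eq0 negb_or => /andP[_ /hp]. Qed.

Lemma weight_inS Q Q' p :
  (forall z, Q z -> Q' z) -> weight_in Q p -> weight_in Q' p.
Proof. by move=> h hp m /hp/h. Qed.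

Lemma weight_in_pvarM Q Q' i p : (forall z, Q z -> Q' (z + (w i)%:Z)) ->
  weight_in Q p -> weight_in Q' (pvar i * p).
Proof.
move=> h hp m; have [mi|mi] := posnP (m i); first by rewrite mcoeff_pvarM0 ?eqxx.
have [m' ->] := mulcm_ucm_gt0 mi; rewrite mcoeff_pvarM_ucm => /hp/h.
by rewrite mweight_ofM mweight_ofU PoszD.
Qed.

Lemma weight_in_dpart Q Q' i p : (forall z, Q z -> Q' (z - (w i)%:Z)) ->
  weight_in Q p -> weight_in Q' (dpart i p).
Proof.
move=> h hp m; rewrite mcoeff_dpart => nz.
have /hp/h : p@_(m * ucm i)%M != 0.
  by apply: contra nz => /eqP->; rewrite mul0rn.
by rewrite mweight_ofM mweight_ofU PoszD addrK.
Qed.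

Lemma weight_in_exists_bound p :
  exists d : nat, weight_in (fun z => (z <= d%:Z)%R) p.
Proof.
exists (\max_(m <- msupp p) mweight_of w m)%N => m.
by rewrite mcoeff_neq0 lez_nat => mp; rewrite (leq_bigmax_seq _ mp).
Qed.

Lemma weight_le_lt0 (d : int) p :
  d < 0 -> weight_in (fun z => (z <= d)%R) p -> p = 0.
Proof.
move=> d0 h; apply/malgP => m; rewrite mcoeff0; apply/eqP/negPn/negP => /h hm.
by have := le_lt_trans hm d0.
Qed.

End WeightSupport.

(** * Virasoro operators on a module with creation and annihilation operators *)

Lemma dfact_gt0 n : (0 < dfact n)%N.
Proof.
suff: (0 < dfact n)%N /\ (0 < dfact n.+1)%N by case.
by elim: n => [|n [h1 h2]]; split; rewrite //= muln_gt0.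
Qed.

Lemma dfactS n : dfact n.*2.+1 = (n.*2.+1 * dfact n.*2.-1)%N.
Proof. by case: n. Qed.

Definition locally_null (C : pzRingType) (V : lmodType C) (D : nat -> V -> V) :=
  forall p, exists K, forall k, (K <= k)%N -> D k p = 0.

Section Virasoro.
Context {C : numFieldType}.

(** The formula of [virasoro] with multiplication by T_i and d/dT_i replaced by arbitrary operators,
    so that it serves both the variables T_k of one tau-function and each family T^a_k. *)
Definition vir (V : lmodType C) (X D : nat -> V -> V) (m : int) (p : V) : V :=
    2^-1 *: (if m is Negz n then
               \sum_(i < n.+1) ((dfact i.*2.-1 * dfact (n - i).*2.-1)%:R)^-1 *:
                 X i (X (n - i)%N p)
             else 0)
  + \sum_(k \in [set: nat]%classic)
      (if k%:Z + m is Posz l then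
         ((dfact l.*2.+1)%:R / (dfact k.*2.-1)%:R) *: X k (D l p)
       else 0)
  + 2^-1 *: (if m is Posz n then
               \sum_(i < n) (dfact i.*2.+1 * dfact (n - i.+1).*2.+1)%:R *:
                 D i (D (n - i.+1)%N p)
             else 0).

Section Family.
Context {V : lmodType C} {X D : nat -> V -> V}.
Hypothesis X_linear : forall i, linear (X i).
Hypothesis D_linear : forall i, linear (D i).
Hypothesis D_null : locally_null D.

Let vir_term (m : int) (k : nat) (p : V) :=
  if k%:Z + m is Posz l then
    ((dfact l.*2.+1)%:R / (dfact k.*2.-1)%:R : C) *: X k (D l p)
  else 0.

Lemma vir_term_null m : locally_null (vir_term m).
Proof.
move=> p; have [K hK] := D_null p; exists (K + `|m|)%N => k hk; rewrite /vir_term.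
case e : (_ + _) => [l|//]; rewrite hK ?(lin0 (X_linear k)) ?scaler0//; lia.
Qed.

Lemma vir_linear m : linear (vir X D m).
Proof.
move=> c p q; rewrite /vir.
have -> F1 F2 F3 G1 G2 G3 : c *: (F1 + F2 + F3) + (G1 + G2 + G3) =
    (c *: F1 + G1) + (c *: F2 + G2) + (c *: F3 + G3) :> V.
  by rewrite !scalerDr addrACA; congr (_ + _); rewrite addrACA.
congr (_ + _ + _).
- rewrite scalerA mulrC -scalerA -scalerDr; congr (_ *: _).
  case: m => n; first by rewrite scaler0 addr0.
  rewrite scaler_sumr -big_split/=; apply: eq_bigr => i _.
  by rewrite !X_linear scalerDr !scalerA mulrC.
- apply: (@fsum_linear C V V [set: nat]%classic (vir_term m)); last first.
    exact: vir_term_null.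
  move=> k {}c {}p {}q; rewrite /vir_term; case: (_ + _) => l; last first.
    by rewrite scaler0 addr0.
  by rewrite D_linear X_linear scalerDr !scalerA mulrC.
- rewrite scalerA mulrC -scalerA -scalerDr; congr (_ *: _).
  case: m => n; last by rewrite scaler0 addr0.
  rewrite scaler_sumr -big_split/=; apply: eq_bigr => i _.
  by rewrite !D_linear scalerDr !scalerA mulrC.
Qed.

(** The operator is built from X, D and scalars only. This transports constraints into a family,
    moves factors free of a family out of its operators, and makes different families commute. *)
Lemma vir_intertwine (V' : lmodType C) (X' D' : nat -> V' -> V') (B : V -> V') m p :
  linear B -> (forall k q, B (X k q) = X' k (B q)) ->
  (forall k q, B (D k q) = D' k (B q)) ->
  B (vir X D m p) = vir X' D' m (B p).
Proof.
move=> BL BX BD; rewrite /vir !(linD BL) !(linZ BL); congr (_ *: _ + _ + _ *: _).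
- case: m => n; rewrite ?(lin0 BL)// (lin_sum BL); apply: eq_bigr => i _.
  by rewrite (linZ BL) !BX.
- have [K hK] := vir_term_null m p.
  rewrite (@fsum_map V V' B [set: nat]%classic (fun k => vir_term m k p) K)//.
    by apply: eq_fsbigr => k _; rewrite /vir_term; case: (_ + _) => l;
      rewrite ?(lin0 BL)// (linZ BL) BX BD.
  by move=> s Q G; rewrite (lin_sum BL).
- case: m => n; rewrite ?(lin0 BL)// (lin_sum BL); apply: eq_bigr => i _.
  by rewrite (linZ BL) !BD.
Qed.

Hypothesis D_comm : forall i j p, D i (D j p) = D j (D i p).
Hypothesis D_X : forall i j p, D i (X j p) = p *+ (i == j) + X j (D i p).

(** For m >= 0 there is no term T_i T_k, and T_j occurs only in the first-order part; the commutator
    is therefore a single derivative. *)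
Lemma D_vir (m j : nat) p :
  D j (vir X D m%:Z p) = vir X D m%:Z (D j p) +
    ((dfact (j + m).*2.+1)%:R / (dfact j.*2.-1)%:R) *: D (j + m)%N p.
Proof.
rewrite /vir !scaler0 !add0r (linD (D_linear j)) (linZ (D_linear j)).
have [K hK] := D_null p.
have [K' hK'] : exists K', forall k, (K' <= k)%N -> D k (D j p) = 0.
  by exists K => k /hK; rewrite D_comm => ->; exact: (lin0 (D_linear j)).
(* The bound exceeds j, so that the one term in which D j meets X j survives the truncation. *)
pose M := maxn j.+1 (maxn K K').
have eT q : (forall k, (M <= k)%N -> D k q = 0) ->
    \sum_(k \in [set: nat]%classic) vir_term m%:Z k q =
    \sum_(k < M) ((dfact (k + m).*2.+1)%:R / (dfact k.*2.-1)%:R) *: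
       X k (D (k + m)%N q).
  move=> h; rewrite (@fsum_setT _ _ M)// => k hk; rewrite /vir_term -PoszD.
  by rewrite h ?(lin0 (X_linear k)) ?scaler0//; lia.
have h1 k : (M <= k)%N -> D k p = 0 by move=> hk; apply: hK; lia.
have h2 k : (M <= k)%N -> D k (D j p) = 0 by move=> hk; apply: hK'; lia.
have := eT _ h1; have := eT _ h2; rewrite /vir_term => -> ->.
rewrite !(lin_sum (D_linear j)).
have jM : (j < M)%N by lia.
rewrite [RHS]addrAC; congr (_ + _).
  under eq_bigr => k _ do rewrite (linZ (D_linear j)) D_X scalerDr.
  rewrite big_split/= addrC; congr (_ + _).
    by apply: eq_bigr => k _; rewrite D_comm.
  rewrite (bigD1 (Ordinal jM))//= eqxx mulr1n big1 ?addr0// => k kj.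
  rewrite (_ : (j == k) = false) ?mulr0n ?scaler0//.
  by apply: contraNF kj => /eqP e; apply/eqP/val_inj.
congr (_ *: _); apply: eq_bigr => i _; rewrite (linZ (D_linear j)); congr (_ *: _).
by rewrite D_comm; congr (D i _); rewrite D_comm.
Qed.
End Family.
End Virasoro.

(** * Weights on an abstract Fock space *)

Section Weighting.
Context {C : numFieldType} {V : lmodType C} {I : Type} {X D : I -> V -> V}.

(* [win Q p] stands for: the weight of every monomial of p satisfies Q. *)
Record weighting (w : I -> nat) := Weighting {
  win : (int -> Prop) -> V -> Prop;
  win0 : forall Q, win Q 0;
  winD : forall Q p q, win Q p -> win Q q -> win Q (p + q);
  winZ : forall Q c p, win Q p -> win Q (c *: p);
  winS : forall (Q Q' : int -> Prop) p,
    (forall z, Q z -> Q' z) -> win Q p -> win Q' p;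
  win_X : forall (Q Q' : int -> Prop) i p,
    (forall z, Q z -> Q' (z + (w i)%:Z)) -> win Q p -> win Q' (X i p);
  win_D : forall (Q Q' : int -> Prop) i p,
    (forall z, Q z -> Q' (z - (w i)%:Z)) -> win Q p -> win Q' (D i p);
  win_bound : forall p, exists d : nat, win (fun z => (z <= d%:Z)%R) p;
  win_lt0 : forall (d : int) p, d < 0 -> win (fun z => (z <= d)%R) p -> p = 0
}.

Context {w : I -> nat} (W : weighting w).

Definition wle (d : int) (p : V) := win W (fun z => (z <= d)%R) p.

Lemma win_sum Q (J : Type) (s : seq J) (P : pred J) (F : J -> V) :
  (forall j, P j -> win W Q (F j)) -> win W Q (\sum_(j <- s | P j) F j).
Proof. by move=> h; apply: big_ind => //; [exact: win0|exact: winD]. Qed.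

Lemma wle_trans (d e : int) p : (d <= e)%R -> wle d p -> wle e p.
Proof. by move=> de; apply: winS => z /le_trans; apply. Qed.

Lemma wle_lt0 (d : int) p : d < 0 -> wle d p -> p = 0.
Proof. exact: win_lt0. Qed.

Lemma wle_D (d : int) i p : wle d p -> wle (d - (w i)%:Z) (D i p).
Proof. by apply: win_D => z; rewrite lerD2r. Qed.

Lemma wle_D0 (d : int) i p : (d < (w i)%:Z)%R -> wle d p -> D i p = 0.
Proof. by move=> di /(wle_D i); apply: wle_lt0; rewrite subr_lt0. Qed.

Section VirasoroWeight.
Context (x : nat -> I) (b : nat).
Hypothesis b_gt0 : (0 < b)%N.
Hypothesis X_linear : forall i, linear (X i).
Hypothesis w_x : forall k, w (x k) = (b * k.*2.+1)%N.

Let L m := vir (fun k => X (x k)) (fun k => D (x k)) m.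

Lemma D_locally_null : locally_null (fun k => D (x k)).
Proof.
move=> p; have [d hd] := win_bound W p; exists d => k dk.
by apply: (wle_D0 _ hd); rewrite w_x ltz_nat -mul2n; nia.
Qed.

(** With T_k of weight b (2k+1), the terms T_i T_j with i + j = -m-1, T_k d/dT_(k+m), and second
    derivatives with i + j = m-1 all change the weight by exactly -2bm. *)
Lemma win_vir (Q Q' : int -> Prop) m p :
  (forall z, Q z -> Q' (z - b.*2%:Z * m)) -> win W Q p -> win W Q' (L m p).
Proof.
move=> h hp; apply: winD; first apply: winD.
- apply: winZ; case: m h => n h; first exact: win0.
  apply: win_sum => i _; apply: winZ => /=.
  apply: (@win_X _ W (fun z => Q (z - (w (x (n - i)%N))%:Z))); last first.
    by apply: win_X hp => z; rewrite addrK.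
  move=> z /h; congr Q'; rewrite !w_x.
  by have := ltn_ord i; rewrite ltnS => ?; rewrite -!mul2n NegzE; nia.
- have [K hK] : exists K, forall k, (K <= k)%N ->
      (if k%:Z + m is Posz l then
        ((dfact l.*2.+1)%:R / (dfact k.*2.-1)%:R : C) *: X (x k) (D (x l) p)
       else 0) = 0.
    exact: (vir_term_null (fun k => X_linear (x k)) D_locally_null m p).
  rewrite (fsum_setT hK); apply: win_sum => k _.
  case e : (_ + _) => [l|l]; last exact: win0.
  apply: winZ => /=; apply: (@win_X _ W (fun z => Q (z + (w (x l))%:Z))); last first.
    by apply: win_D hp => z; rewrite subrK.
  move=> z /h; congr Q'; rewrite !w_x (_ : m = l%:Z - k%:Z); first nia.
  by rewrite -e; lia.
- apply: winZ; case: m h => n h; last exact: win0.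
  apply: win_sum => i _; apply: winZ => /=.
  apply: (@win_D _ W (fun z => Q (z + (w (x (n - i.+1)%N))%:Z))); last first.
    by apply: win_D hp => z; rewrite subrK.
  move=> z /h; congr Q'; rewrite !w_x.
  by have := ltn_ord i => ?; rewrite -!mul2n; nia.
Qed.

Lemma vir_locally_null : locally_null (fun k => L k%:Z).
Proof.
move=> p; have [d hd] := win_bound W p; exists d.+1 => k dk.
apply: (@wle_lt0 (d%:Z - b.*2%:Z * k%:Z)).
  by rewrite -mul2n; nia.
by apply: win_vir hd => z; rewrite lerD2r.
Qed.

End VirasoroWeight.
End Weighting.

(** * Exponentials of locally nilpotent operators *)

Section DividedPowers.
Context {C : numFieldType} {V : lmodType C}.
Implicit Types (A B : V -> V) (p : V).

Lemma mulrSn_inj n : injective (fun u : V => u *+ n.+1).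
Proof.
move=> u v /=; rewrite -!scaler_nat => /(congr1 (fun t => n.+1%:R^-1 *: t)).
by rewrite !scalerA mulVf ?pnatr_eq0// !scale1r.
Qed.

Definition dpow A n p : V := (n`!%:R)^-1 *: iter n A p.

Lemma iter_linear A n : linear A -> linear (iter n A).
Proof. by move=> AL; elim: n => [|n IH] c p q //=; rewrite IH AL. Qed.

Lemma dpow_linear A n : linear A -> linear (dpow A n).
Proof.
move=> AL c p q; rewrite /dpow (iter_linear n AL) scalerDr !scalerA.
by rewrite mulrC.
Qed.

Lemma dpow0 A p : dpow A 0 p = p.
Proof. by rewrite /dpow fact0 invr1 scale1r. Qed.

Lemma dpowS A n p : linear A -> dpow A n.+1 p *+ n.+1 = A (dpow A n p).
Proof.
move=> AL; rewrite /dpow (linZ AL) -scaler_nat scalerA factS natrM invfM.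
by rewrite mulrA divff ?mul1r// pnatr_eq0.
Qed.

Lemma iter_comm A B n p : (forall q, A (B q) = B (A q)) ->
  iter n A (B p) = B (iter n A p).
Proof. by move=> AB; elim: n => //= n ->; rewrite AB. Qed.

(** Coefficientwise, exp(t A) p is the only solution of E' = A E with E(0) = p. Identities between
    exponentials are proved by checking this recursion. *)
Lemma dpow_unique A p (E : nat -> V) : linear A -> E 0%N = p ->
  (forall n, E n.+1 *+ n.+1 = A (E n)) -> forall n, dpow A n p = E n.
Proof.
move=> AL E0 ES; elim=> [|n IH]; first by rewrite dpow0.
by apply: (@mulrSn_inj n); rewrite dpowS// IH ES.
Qed.

Lemma dpowD A B n p : linear A -> linear B -> (forall q, A (B q) = B (A q)) ->
  dpow (fun q => A q + B q) n p = \sum_(i < n.+1) dpow A i (dpow B (n - i) p).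
Proof.
move=> AL BL AB.
have SL : linear (fun q => A q + B q).
  by move=> c u v; rewrite AL BL scalerDr addrACA.
apply: (dpow_unique (E := fun n => \sum_(i < n.+1) dpow A i (dpow B (n - i) p))
  SL) => [|{}n]; first by rewrite big_ord1 !dpow0.
rewrite (cauchy_succ (fun i j => dpow A i (dpow B j p))).
rewrite (lin_sum AL) (lin_sum BL); congr (_ + _); apply: eq_bigr => i _.
  exact: dpowS.
rewrite -(linMn (dpow_linear i AL)) dpowS// /dpow iter_comm ?(linZ BL)//.
Qed.

Section LocallyNilpotent.
(* F d p : p has filtration degree at most d *)
Context (F : int -> V -> Prop).
Hypothesis F_lt0 : forall d p, d < 0 -> F d p -> p = 0.
Hypothesis F_bound : forall p, exists d : nat, F d%:Z p.

Definition lowering A := forall d p, F d p -> F (d - 1) (A p).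

Lemma lowering_iter A n d p : lowering A -> F d p -> F (d - n%:Z) (iter n A p).
Proof.
move=> lA dp; elim: n => [|n IH] /=; first by rewrite subr0.
by have := lA _ _ IH; congr F; lia.
Qed.

Definition aexp A p : V :=
  \sum_(j \in [set: nat]%classic) (j`!%:R)^-1 *: iter j A p.

Lemma dpow_null A (d n : nat) p : linear A -> lowering A -> F d%:Z p ->
  (d < n)%N -> dpow A n p = 0.
Proof.
move=> AL lA dp dn; rewrite /dpow (F_lt0 _ (lowering_iter n lA dp)) ?scaler0//.
by rewrite subr_lt0 ltz_nat.
Qed.

Lemma aexpE A (d K : nat) p : linear A -> lowering A -> F d%:Z p -> (d < K)%N ->
  aexp A p = \sum_(n < K) dpow A n p.
Proof.
move=> AL lA dp dK; rewrite /aexp (@fsum_setT _ _ K)// => k Kk.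
by apply: (dpow_null AL lA dp); exact: leq_trans Kk.
Qed.

Lemma aexp_linear A : linear A -> lowering A -> linear (aexp A).
Proof.
move=> AL lA; apply: fsum_linear => [n|p]; first exact: dpow_linear.
have [d dp] := F_bound p; exists d.+1 => k dk; exact: (dpow_null AL lA dp).
Qed.

(** On p of degree d, the product of the exponentials is a square sum in which only the terms with i
    + j <= d survive. [F] is not assumed stable under sums, hence the separate condition on A +
    B. *)
Lemma aexpD A B p : linear A -> linear B -> lowering A -> lowering B ->
    (forall q, A (B q) = B (A q)) -> lowering (fun q => A q + B q) ->
  aexp (fun q => A q + B q) p = aexp A (aexp B p).
Proof.
move=> AL BL lA lB AB lS; have [d dp] := F_bound p.
have SL : linear (fun q => A q + B q).
  by move=> c u v; rewrite AL BL scalerDr addrACA.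
rewrite (aexpE SL lS dp (ltnSn d)) (aexpE BL lB dp (ltnSn d)).
rewrite (lin_sum (aexp_linear AL lA)).
have iB j : F (d%:Z - j%:Z) (iter j B p) by apply: lowering_iter.
transitivity (\sum_(j < d.+1) \sum_(i < d.+1) dpow A i (dpow B j p)).
  rewrite exchange_big/= (triangle_sum (G := fun i j => dpow A i (dpow B j p))).
    by apply: eq_bigr => n _; exact: dpowD.
  move=> i j dij; rewrite /dpow (linZ (iter_linear i AL)).
  rewrite (F_lt0 _ (lowering_iter i lA (iB j))) ?scaler0//; lia.
apply: eq_bigr => j _; rewrite /dpow (linZ (aexp_linear AL lA)).
rewrite (aexpE (d := d - j) (K := d.+1) AL lA).
- rewrite scaler_sumr; apply: eq_bigr => i _.
  by rewrite /dpow (linZ (iter_linear i AL)) !scalerA mulrC.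
- by have := iB j; rewrite -subzn// -ltnS.
- by rewrite ltnS leq_subr.
Qed.

Lemma aexp_fix A p : linear A -> A p = 0 -> aexp A p = p.
Proof.
move=> AL Ap; rewrite /aexp (@fsum_setT _ _ 1).
  by rewrite big_ord1 fact0 invr1 scale1r.
case=> // k _; rewrite iterSr Ap (lin0 (iter_linear k AL)) scaler0//.
Qed.

Lemma aexpNK A B p : (forall d, F d 0) -> linear A -> linear B ->
  lowering A -> lowering B -> (forall q, A q = - B q) -> aexp A (aexp B p) = p.
Proof.
move=> F0 AL BL lA lB AB; rewrite -aexpD//.
- apply: aexp_fix => [c u v|]; last by rewrite AB addNr.
  by rewrite !AB !addNr scaler0 addr0.
- by move=> q; rewrite !AB (linN BL).
- by move=> d q dq; rewrite AB addNr.
Qed.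

End LocallyNilpotent.
End DividedPowers.

(** * Comparing exp(t X) with the exponential of a t-dependent shift *)

Section ShiftExponential.
Context {C : numFieldType} {U : lmodType C}.

(** The coefficient of t^n in (sum_i t^(i+1) Z_i) G(t); the shift in the exponent explains the value
    0 at n = 0. *)
Definition conv (Z : nat -> U -> U) (G : nat -> U) : nat -> U :=
  fun n => if n is n'.+1 then \sum_(i < n'.+1) Z i (G (n' - i)%N) else 0.

Lemma eq_conv Z (G H : nat -> U) n : (forall k, (k < n)%N -> G k = H k) ->
  conv Z G n = conv Z H n.
Proof.
case: n => //= n GH; apply: eq_bigr => i _; rewrite GH// ltnS leq_subr//.
Qed.

Lemma conv_comm (Z Z' : nat -> U -> U) G n :
  (forall i, linear (Z i)) -> (forall i, linear (Z' i)) ->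
  (forall i j F, Z i (Z' j F) = Z' j (Z i F)) ->
  conv Z (conv Z' G) n = conv Z' (conv Z G) n.
Proof.
move=> ZL ZL' ZZ'; case: n => //= n.
have e (T T' : nat -> U -> U) : (forall i, linear (T i)) ->
    \sum_(i < n.+1) T i (conv T' G (n - i)%N) =
    \sum_(i < n) \sum_(j < (n - i.+1).+1) T i (T' j (G (n - i.+1 - j)%N)).
  move=> TL; rewrite big_ord_recr/= subnn (lin0 (TL n)) addr0.
  apply: eq_bigr => i _; rewrite /conv.
  have -> : (n - i = (n - i.+1).+1)%N by have := ltn_ord i; lia.
  by rewrite (lin_sum (TL i)).
rewrite !e//; case: n {e} => [|n]; first by rewrite !big_ord0.
under eq_bigr do rewrite subSS.
under [RHS]eq_bigr do rewrite subSS.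
rewrite (sum_antidiagA (fun i j k => Z i (Z' j (G k)))).
by apply: eq_bigr => j _; apply: eq_bigr => i _.
Qed.

Context (X : U -> U) (Y : nat -> U -> U) (tau : U).
Hypothesis X_linear : linear X.
Hypothesis Y_linear : forall i, linear (Y i).
Hypothesis Y_comm : forall i j F, Y i (Y j F) = Y j (Y i F).
(** With Y(t) = sum_i t^(i+1) Y_i this reads [X, Y] = Y' - Y_0. Then E = exp(Y) tau satisfies X E =
    (Y' - Y_0) E + Y_0 E = E', the equation that characterises exp(t X) tau. *)
Hypothesis X_Y : forall i F, X (Y i F) = Y i (X F) + Y i.+1 F *+ i.+2.
Hypothesis X_tau : X tau = Y 0%N tau.

(* [bell j n] is the coefficient of t^n in (\sum_i t^(i+1) Y_i)^j tau. *)
Definition bell j : nat -> U :=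
  iter j (conv Y) (fun n => if n is 0%N then tau else 0).

Arguments bell : simpl never.

Lemma bellS j : bell j.+1 = conv Y (bell j). Proof. by []. Qed.

(** [conv Y'] is the action of t dY/dt, and [conv Y''] that of the commutator [X, Y(t)] = dY/dt -
    Y_0. *)
Let Y' i F := Y i F *+ i.+1.
Let Y'' i F := Y i.+1 F *+ i.+2.

Let Y'_linear i : linear (Y' i).
Proof. by move=> c u v; rewrite /Y' Y_linear mulrnDl scalerMnr. Qed.

Let Y''_linear i : linear (Y'' i).
Proof. by move=> c u v; rewrite /Y'' Y_linear mulrnDl scalerMnr. Qed.

Lemma bell_lt j n : (n < j)%N -> bell j n = 0.
Proof.
elim: j n => [|j IH] [|n]//= nj; rewrite bellS; apply: big1 => i _.
by rewrite IH ?(lin0 (Y_linear i))//; lia.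
Qed.

Let conv_degree G n : conv Y G n *+ n =
  conv Y' G n + conv Y (fun k => G k *+ k) n.
Proof.
case: n => [|n] /=; first by rewrite mulr0n addr0.
rewrite -sumrMnl -big_split/=; apply: eq_bigr => i _.
rewrite (linMn (Y_linear i)) -mulrnDr; congr (_ *+ _).
by have := ltn_ord i; lia.
Qed.

Let convMn G k n : conv Y (fun m => G m *+ k) n = conv Y G n *+ k.
Proof.
case: n => [|n] /=; first by rewrite mul0rn.
by rewrite -sumrMnl; apply: eq_bigr => i _; rewrite (linMn (Y_linear i)).
Qed.

Let convD G H n : conv Y (fun m => G m + H m) n = conv Y G n + conv Y H n.
Proof.
case: n => [|n] /=; first by rewrite addr0.
by rewrite -big_split/=; apply: eq_bigr => i _; rewrite (linD (Y_linear i)).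
Qed.

(** Since the Y_i commute, t d/dt of Y(t)^(j+1) is (j+1) t Y'(t) Y(t)^j. *)
Lemma bell_degree j n : bell j.+1 n *+ n = conv Y' (bell j) n *+ j.+1.
Proof.
elim: j n => [|j IH] n; rewrite bellS conv_degree.
  rewrite (@eq_conv Y _ (fun m => 0 *+ 0)); last by case=> [|m] _ /=; rewrite mul0rn.
  by rewrite convMn addr0.
rewrite (@eq_conv Y _ (fun k => conv Y' (bell j) k *+ j.+1)) => [|k _]; last exact: IH.
have YY' i k F : Y i (Y' k F) = Y' k (Y i F).
  by rewrite /Y' (linMn (Y_linear i)) Y_comm.
by rewrite convMn (conv_comm _ _ Y_linear Y'_linear YY') [RHS]mulrS.
Qed.

Let X_conv G n : X (conv Y G n) = conv Y (fun k => X (G k)) n + conv Y'' G n.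
Proof.
case: n => [|n] /=; first by rewrite (lin0 X_linear) addr0.
by rewrite (lin_sum X_linear) -big_split/=; apply: eq_bigr => i _; rewrite X_Y.
Qed.

(** Moving X through Y(t)^j yields j copies of [X, Y(t)] Y(t)^(j-1), which commute with the rest,
    and finally X tau = Y_0 tau. At j = 0 the value of [j.-1] is irrelevant, the term being taken 0
    times. *)
Lemma X_bell j n :
  X (bell j n) = Y 0%N (bell j n) + conv Y'' (bell j.-1) n *+ j.
Proof.
elim: j n => [|j IH] n.
  rewrite mulr0n addr0 /bell/=.
  by case: n => //; rewrite (lin0 X_linear) (lin0 (Y_linear 0)).
rewrite bellS X_conv.
rewrite (@eq_conv Y _ (fun k => Y 0%N (bell j k) + conv Y'' (bell j.-1) k *+ j))
  => [|k _]; last exact: IH.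
rewrite convD convMn -addrA; congr (_ + _).
  case: n => [|n] /=; first by rewrite (lin0 (Y_linear 0)).
  by rewrite (lin_sum (Y_linear 0)); apply: eq_bigr => i _; rewrite Y_comm.
have YY'' i k F : Y i (Y'' k F) = Y'' k (Y i F).
  by rewrite /Y'' (linMn (Y_linear i)) Y_comm.
rewrite (conv_comm _ _ Y_linear Y''_linear YY'').
case: j {IH} => [|j]; first by rewrite mulr0n add0r mulr1n.
by rewrite [RHS]mulrSr.
Qed.

Let conv_split G n : conv Y' G n.+1 = Y 0%N (G n) + conv Y'' G n.
Proof.
rewrite /= big_ord_recl/= subn0 /Y' mulr1n; congr (_ + _).
case: n => [|n] /=; first by rewrite big_ord0.
by apply: eq_bigr => i _.
Qed.

(* exp(t X) tau = exp(\sum_i t^(i+1) Y_i) tau, compared at t^n *)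
Lemma dpow_bell n :
  dpow X n tau = \sum_(j < n.+1) (j`!%:R)^-1 *: bell j n.
Proof.
apply: (dpow_unique (E := fun n => \sum_(j < n.+1) (j`!%:R)^-1 *: bell j n)
  X_linear) => [|{}n].
  by rewrite big_ord1 fact0 invr1 scale1r.
rewrite -sumrMnl big_ord_recl/= [bell 0 n.+1]/bell/= scaler0 mul0rn add0r.
rewrite (lin_sum X_linear).
transitivity (\sum_(j < n.+1)
    (j`!%:R)^-1 *: (Y 0%N (bell j n) + conv Y'' (bell j) n)).
  apply: eq_bigr => j _; rewrite /bump/= add1n scalerMnr bell_degree conv_split.
  rewrite -scaler_nat scalerA; congr (_ *: _).
  by rewrite factS natrM invfM mulrC mulrA divff ?mul1r// pnatr_eq0.
under eq_bigr do rewrite scalerDr.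
under [RHS]eq_bigr do rewrite (linZ X_linear) X_bell scalerDr.
rewrite !big_split/=; congr (_ + _).
(* The sums differ by the shift from j to j + 1. The last term on the left vanishes because Y(t)^n
   has order at least n in t and [conv] raises the order; the first term on the right has
   multiplicity 0. *)
rewrite [LHS]big_ord_recr [RHS]big_ord_recl/= mulr0n scaler0 add0r.
rewrite [X in _ + X = _](_ : _ = 0) ?addr0; last first.
  rewrite (_ : conv _ _ _ = 0) ?scaler0//.
  case: n => //= n; apply: big1 => i _.
  by rewrite bell_lt /Y'' ?(lin0 (Y_linear i.+1)) ?mul0rn//; lia.
apply: eq_bigr => j _; rewrite /bump/= add1n -scaler_nat scalerA; congr (_ *: _).
by rewrite factS natrM invfM mulrC mulrA divff ?mul1r// pnatr_eq0.
Qed.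
End ShiftExponential.
Arguments bell : simpl never.

(** * Exchanging a translation for a Virasoro group element *)

Section FockSpace.
Context {C : numFieldType} {V : lmodType C} {N : nat}.
Context {X D : 'I_N * nat -> V -> V}.
Hypothesis X_linear : forall i, linear (X i).
Hypothesis D_linear : forall i, linear (D i).
Hypothesis X_comm : forall i j p, X i (X j p) = X j (X i p).
Hypothesis D_comm : forall i j p, D i (D j p) = D j (D i p).
Hypothesis D_X : forall i j p, D i (X j p) = p *+ (i == j) + X j (D i p).

Section VirasoroGroup.
Context {w : 'I_N * nat -> nat} (W : weighting (X := X) (D := D) w).
Context (b : 'I_N -> nat).
Hypothesis b_gt0 : forall a, (0 < b a)%N.
Hypothesis w_b : forall a k, w (a, k) = (b a * k.*2.+1)%N.

Definition Lvir a m := vir (fun k => X (a, k)) (fun k => D (a, k)) m.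

Lemma D_fam_null a : locally_null (fun k => D (a, k)).
Proof. exact: (D_locally_null W (b_gt0 a) (w_b a)). Qed.

Lemma D_all_null p : exists K, forall k, (K <= k)%N -> forall a, D (a, k) p = 0.
Proof.
have [d hd] := win_bound W p; exists d => k dk a.
by apply: (wle_D0 _ hd); rewrite w_b ltz_nat -mul2n; have := b_gt0 a; nia.
Qed.

Lemma Lvir_linear a m : linear (Lvir a m).
Proof.
by apply: vir_linear => [i|i|]; [exact: X_linear|exact: D_linear|exact: D_fam_null].
Qed.

Lemma Lvir_null a : locally_null (fun k => Lvir a k%:Z).
Proof. exact: (vir_locally_null W (b_gt0 a) X_linear (w_b a)). Qed.

Context (chi : 'I_N -> nat -> C).
Hypothesis chi0 : forall a, chi a 0%N = 0.

Definition LV a p := \sum_(k \in [set: nat]%classic) chi a k *: Lvir a k%:Z p.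

Let LVt_null a : locally_null (fun k p => chi a k *: Lvir a k%:Z p).
Proof.
move=> p; have [K hK] := Lvir_null a p; exists K => k /hK ->; exact: scaler0.
Qed.

Lemma LV_linear a : linear (LV a).
Proof.
apply: fsum_linear => [k c u v|]; last exact: LVt_null.
by rewrite Lvir_linear scalerDr !scalerA mulrC.
Qed.

Lemma LV_lowering a : lowering (wle W) (LV a).
Proof.
move=> d p dp; have [K hK] := LVt_null a p.
rewrite /LV (fsum_setT hK); apply: win_sum => -[[|k] /= _] _.
  (* L_0 preserves the weight, so the exponential is locally finite only because chi_0 = 0. *)
  by rewrite chi0 scale0r; exact: win0.
apply: winZ.
refine (win_vir (b_gt0 a) X_linear (w_b a) (Q := fun z => (z <= d)%R) _ dp).
move=> z zd; by have := b_gt0 a; rewrite -mul2n => ?; nia.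
Qed.

Lemma LV_intertwine a (B : V -> V) p : linear B ->
  (forall k q, B (X (a, k) q) = X (a, k) (B q)) ->
  (forall k q, B (D (a, k) q) = D (a, k) (B q)) ->
  B (LV a p) = LV a (B p).
Proof.
move=> BL BX BD; have [K hK] := LVt_null a p.
rewrite /LV (@fsum_map V V B _ (fun k => chi a k *: Lvir a k%:Z p) K)//; last first.
  by move=> s Q G; exact: lin_sum.
apply: eq_fsbigr => k _; rewrite (linZ BL); congr (_ *: _).
exact: (vir_intertwine (fun k => X_linear (a, k)) (D_fam_null a)).
Qed.

Lemma LV_comm a c p : LV a (LV c p) = LV c (LV a p).
Proof.
have [->//|ac] := eqVneq a c.
have ne k j : ((a, k) == (c, j)) = false by rewrite xpair_eqE (negPf ac).
apply: (LV_intertwine _ (LV_linear a)) => j q; apply/esym; apply: LV_intertwine.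
- exact: X_linear.
- by move=> k q'; rewrite X_comm.
- by move=> k q'; rewrite D_X ne mulr0n add0r.
- exact: D_linear.
- by move=> k q'; rewrite D_X eq_sym ne mulr0n add0r.
- by move=> k q'; rewrite D_comm.
Qed.

Definition LVsum (r : seq 'I_N) p := \sum_(a <- r) LV a p.

Lemma LVsum_linear r : linear (LVsum r).
Proof.
move=> c u v; rewrite /LVsum scaler_sumr -big_split/=.
by apply: eq_bigr => a _; rewrite LV_linear.
Qed.

Lemma LVsum_lowering r : lowering (wle W) (LVsum r).
Proof. by move=> d p dp; apply: win_sum => a _; exact: LV_lowering. Qed.

(** Families act on disjoint variables, so their fields commute and the product of exponentials is
    one exponential, to which the comparison with a shift applies directly. *)
Lemma aexp_LVsum r p :
  aexp (LVsum r) p = (\big[comp/id]_(a <- r) aexp (LV a)) p.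
Proof.
elim: r p => [|a r IH] p.
  rewrite big_nil aexp_fix//; last by rewrite /LVsum big_nil.
  exact: LVsum_linear.
rewrite big_cons/= -IH.
have e : LVsum (a :: r) = (fun p => LV a p + LVsum r p).
  by apply/funext => q; rewrite /LVsum big_cons.
rewrite e (aexpD (F := wle W))//.
- by move=> d q; exact: wle_lt0.
- by move=> q; exact: win_bound.
- exact: LV_linear.
- exact: LVsum_linear.
- exact: LV_lowering.
- exact: LVsum_lowering.
- move=> q; rewrite /LVsum (lin_sum (LV_linear a)).
  by apply: eq_bigr => c _; exact: LV_comm.
- by rewrite -e; exact: LVsum_lowering.
Qed.

Definition LVtot := LVsum (index_enum 'I_N).

(** The coefficient of [d/dT_j, L_k], and also that of z^(2k+1) d/dz on z^(2j+1)/(2j+1)!! relative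
    to z^(2(j+k)+1)/(2(j+k)+1)!!. This coincidence identifies shifts with odd power series. *)
Definition vcoef (j k : nat) : C :=
  (dfact (j + k).*2.+1)%:R / (dfact j.*2.-1)%:R.

Lemma D_LVtot a j p : D (a, j) (LVtot p) = LVtot (D (a, j) p) +
  \sum_(k \in [set: nat]%classic) (chi a k * vcoef j k) *: D (a, (j + k)%N) p.
Proof.
rewrite /LVtot /LVsum (lin_sum (D_linear _)) (bigD1 a)//= [in RHS](bigD1 a)//=.
rewrite [RHS]addrAC; congr (_ + _); last first.
  apply: eq_bigr => c ca; apply: LV_intertwine; first exact: D_linear.
    move=> k q; rewrite D_X xpair_eqE eq_sym (negPf ca) mulr0n add0r//.
  by move=> k q; rewrite D_comm.
have [K1 h1] := LVt_null a p; have [K2 h2] := LVt_null a (D (a, j) p).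
have [K3 h3] := D_fam_null a p.
pose K := maxn K1 (maxn K2 K3).
rewrite /LV (@fsum_setT _ _ K) => [|k hk]; last by apply: h1; lia.
rewrite (@fsum_setT _ (fun k => chi a k *: Lvir a k%:Z (D (a, j) p)) K); last first.
  by move=> k hk; apply: h2; lia.
rewrite (@fsum_setT _ _ K) => [|k hk]; last by rewrite h3 ?scaler0//; lia.
rewrite (lin_sum (D_linear _)) -big_split/=; apply: eq_bigr => k _.
rewrite (linZ (D_linear _)) -scalerA -scalerDr; congr (_ *: _).
apply: (D_vir (X := fun k => X (a, k)) (D := fun k => D (a, k))) => //.
  exact: D_fam_null.
by move=> i k' q; rewrite D_X xpair_eqE eqxx.
Qed.

Implicit Types (y : 'I_N -> nat -> C) (F : int -> V).

Definition Yop y F : int -> V := fun m =>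
  \sum_(k \in [set: nat]%classic) \sum_(a < N) y a k *: D (a, k) (F (m + 1)).

Lemma YopE y F m K : (forall k, (K <= k)%N -> forall a, D (a, k) (F (m + 1)) = 0) ->
  Yop y F m = \sum_(k < K) \sum_(a < N) y a k *: D (a, k : nat) (F (m + 1)).
Proof.
by move=> h; apply: fsum_setT => k /h D0; apply: big1 => a _; rewrite D0 scaler0.
Qed.

Definition Aop y a l : C :=
  - \sum_(j < l.+1) y a j * (chi a (l - j)%N * vcoef j (l - j)%N).

Lemma LVtot_linear : linear LVtot. Proof. exact: LVsum_linear. Qed.

Lemma LVtot_Yop y F m : LVtot (Yop y F m) =
  Yop y (fun n => LVtot (F n)) m + Yop (Aop y) F m.
Proof.
set p := F (m + 1).
have [K1 h1] := D_all_null p; have [K2 h2] := D_all_null (LVtot p).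
pose K := maxn K1 K2.
rewrite !(@YopE _ _ _ K) => [|k hk|k hk|k hk];
  try by [apply: h1; lia | apply: h2; lia].
rewrite (lin_sum LVtot_linear) -/p.
under eq_bigr do rewrite (lin_sum LVtot_linear).
rewrite exchange_big [X in _ = X + _]exchange_big [X in _ = _ + X]exchange_big/=.
rewrite -big_split/=; apply: eq_bigr => a _.
transitivity (\sum_(j < K) (y a j *: D (a, j : nat) (LVtot p) -
    \sum_(k < K) (y a j * (chi a k * vcoef j k)) *: D (a, (j + k)%N) p)).
  apply: eq_bigr => j _; rewrite (linZ LVtot_linear) D_LVtot scalerDr.
  rewrite (@fsum_setT _ _ K) => [|k hk]; last by rewrite h1 ?scaler0//; lia.
  rewrite [X in _ = _ + X - _]scaler_sumr.
  by under [X in _ = _ + X - _]eq_bigr do rewrite scalerA; rewrite addrK.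
rewrite big_split/=; congr (_ + _); rewrite sumrN.
rewrite (triangle_sum (G := fun j k => (y a j * (chi a k * vcoef j k)) *:
    D (a, (j + k)%N) p)); last first.
  by move=> i j ij; rewrite h1 ?scaler0//; lia.
rewrite -sumrN; apply: eq_bigr => l _; rewrite /Aop scaleNr scaler_suml.
congr (- _); apply: eq_bigr => j _; rewrite subnKC//.
by rewrite -ltnS.
Qed.

Lemma Yop_linear y : linear (Yop y : (int -> V) -> (int -> V)).
Proof.
move=> c F G; apply/funext => m.
have [K1 h1] := D_all_null (F (m + 1)); have [K2 h2] := D_all_null (G (m + 1)).
pose K := maxn K1 K2.
have D1 k : (K <= k)%N -> forall a, D (a, k) (F (m + 1)) = 0.
  by move=> hk; apply: h1; lia.
have D2 k : (K <= k)%N -> forall a, D (a, k) (G (m + 1)) = 0.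
  by move=> hk; apply: h2; lia.
transitivity (c *: Yop y F m + Yop y G m); last by [].
have cFG : (c *: F + G) (m + 1) = c *: F (m + 1) + G (m + 1) by [].
rewrite (YopE y D1) (YopE y D2) (@YopE _ _ _ K); last first.
  by move=> k hk a; rewrite cFG D_linear D1// D2// scaler0 addr0.
rewrite scaler_sumr -big_split/=; apply: eq_bigr => k _.
rewrite scaler_sumr -big_split/=; apply: eq_bigr => a _.
by rewrite cFG D_linear scalerDr !scalerA mulrC.
Qed.

Lemma Yop_comm y y' F : Yop y (Yop y' F) = Yop y' (Yop y F).
Proof.
apply/funext => m; set p := F (m + 1 + 1).
have [K h] := D_all_null p.
have Y0 z k : (K <= k)%N -> forall a, D (a, k) (Yop z F (m + 1)) = 0.
  move=> hk a; rewrite (@YopE _ _ _ K)// -/p (lin_sum (D_linear _)) big1// => l _.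
  rewrite (lin_sum (D_linear _)) big1// => c _.
  by rewrite (linZ (D_linear _)) D_comm h// (lin0 (D_linear _)) scaler0.
have e z z' : Yop z (Yop z' F) m = \sum_(k < K) \sum_(a < N) \sum_(l < K)
    \sum_(c < N) (z a k * z' c l) *: D (a, k : nat) (D (c, l : nat) p).
  rewrite (YopE z (Y0 z')); apply: eq_bigr => k _; apply: eq_bigr => a _.
  rewrite (@YopE _ _ _ K)// -/p (lin_sum (D_linear _)) scaler_sumr.
  apply: eq_bigr => l _; rewrite (lin_sum (D_linear _)) scaler_sumr.
  by apply: eq_bigr => c _; rewrite (linZ (D_linear _)) scalerA.
rewrite !e.
under eq_bigr do rewrite exchange_big/=.
rewrite exchange_big/=; apply: eq_bigr => l _.
under eq_bigr do rewrite exchange_big/=.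
rewrite exchange_big/=; apply: eq_bigr => c _.
apply: eq_bigr => k _; apply: eq_bigr => a _.
by rewrite mulrC D_comm.
Qed.

Lemma YopMn y n F : Yop (fun a k => y a k *+ n) F = Yop y F *+ n.
Proof.
apply/funext => m; have [K h] := D_all_null (F (m + 1)).
have -> : (Yop y F *+ n) m = Yop y F m *+ n.
  elim: n => [|n IH]; first by rewrite !mulr0n.
  by rewrite !mulrS -IH.
rewrite !(YopE _ h) -sumrMnl; apply: eq_bigr => k _.
by rewrite -sumrMnl; apply: eq_bigr => a _; rewrite scalerMnl.
Qed.

(** * Setting t = 1 *)

Section Evaluation.
Context (al : 'I_N -> nat) (si : 'I_N -> C) (Z : int -> V).
Hypothesis b_al : forall a, (b a * (al a).*2.+1 = 3)%N.
Hypothesis Z_wle : forall m, wle W (3%:Z * m) (Z m).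
Hypothesis L_Z : forall a (k : nat) m, (0 < k)%N ->
  Lvir a k%:Z (Z m) = (si a * (dfact (k + al a).*2.+1)%:R) *:
    D (a, (k + al a)%N) (Z (m + 1)).
(** [ys i] is the coefficient of t^(i+1) in y(t): [ys0] and [ysS] are y' = c + A y, and [ys_lt] is
    the order of vanishing that makes the sums finite. *)
Context (ys : nat -> 'I_N -> nat -> C).
Hypothesis ys0 : forall a l, ys 0 a l =
  if (al a < l)%N then si a * (dfact l.*2.+1)%:R * chi a (l - al a)%N else 0.
Hypothesis ysS : forall i a l, Aop (ys i) a l = ys i.+1 a l *+ i.+2.
Hypothesis ys_lt : forall i a l, (l < al a + i.+1)%N -> ys i a l = 0.

Lemma sum_ord_null (U : zmodType) (F : nat -> U) K K' : (K <= K')%N ->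
  (forall k, (K <= k)%N -> F k = 0) -> \sum_(k < K') F k = \sum_(k < K) F k.
Proof.
move=> KK' h; rewrite -!fsum_setT// => k hk; apply: h; exact: leq_trans hk.
Qed.

Lemma LVtot_Z m : LVtot (Z m) = Yop (ys 0) Z m.
Proof.
have [K1 h1] := D_all_null (Z (m + 1)).
rewrite (YopE _ h1) exchange_big/= /LVtot /LVsum; apply: eq_bigr => a _.
pose G l := ys 0 a l *: D (a, l) (Z (m + 1)).
have G0 l : (K1 <= l)%N -> G l = 0 by move=> /h1 e; rewrite /G e scaler0.
(* The range is enlarged by [al a] so that the substitution l = al a + k loses no term. *)
rewrite -(@sum_ord_null _ G K1 (al a + K1) (leq_addl _ _) G0).
rewrite big_split_ord/= big1 ?add0r; last first.
  by move=> l _; rewrite /G ys0 ltnNge ltnW// scale0r.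
rewrite /LV (@fsum_setT _ _ K1).
  apply: eq_bigr => -[[|k] kK] _; rewrite /G ys0/=.
    by rewrite chi0 addn0 ltnn !scale0r.
  rewrite L_Z// (addnC k.+1) addKn scalerA (_ : (al a < al a + k.+1)%N).
    by rewrite mulrC.
  by rewrite -addSnnS leq_addr.
case=> [|k] kK; first by rewrite chi0 scale0r.
by rewrite L_Z// h1 ?scaler0//; lia.
Qed.

(* F is a Laurent family in hbar, and T^a_k has weight 3 (2k+1) / (2 al a + 1). *)
Definition gr (e : int) (F : int -> V) := forall m, wle W (3%:Z * m - e) (F m).

(** The shift of hbar accounts for 3, whereas d/dT^a_l with l >= al a + i + 1 lowers the weight by
    at least b_a (2 al a + 1) + 2 b_a (i+1), and b_a (2 al a + 1) = 3. The surplus 2(i+1) bounds the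
    powers of t. *)
Lemma Yop_gr i e F : gr e F -> gr (e + i.+1.*2%:Z) (Yop (ys i) F).
Proof.
move=> Fe m; have [K h] := D_all_null (F (m + 1)); rewrite (YopE _ h).
apply: win_sum => k _; apply: win_sum => a _.
have [lt|ge] := ltnP k (al a + i.+1).
  by rewrite ys_lt// scale0r; exact: win0.
apply: winZ; apply: wle_trans (wle_D (a, k : nat) (Fe (m + 1))); rewrite w_b.
have := b_al a; have := b_gt0 a; rewrite -!mul2n => ? ?; nia.
Qed.

Lemma grD e F G : gr e F -> gr e G -> gr e (F + G).
Proof. by move=> hF hG m; apply: winD; [exact: hF|exact: hG]. Qed.

Lemma gr0 e : gr e 0.
Proof. by move=> m; exact: win0. Qed.

Local Notation bellZ := (bell (fun i => Yop (ys i)) Z).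

Lemma bell_gr j n : gr n.*2%:Z (bellZ j n).
Proof.
elim: j n => [|j IH] [|n].
- by move=> m; rewrite subr0; exact: Z_wle.
- exact: gr0.
- exact: gr0.
- rewrite bellS; apply: (big_ind (gr n.+1.*2%:Z)); [exact: gr0|exact: grD|].
  move=> i _; have := Yop_gr i (IH (n - i)%N); congr (gr _ _).
  by have := ltn_ord i; rewrite -!mul2n; lia.
Qed.

Lemma bell_vanish j n (m : int) : 3%:Z * m < n.*2%:Z -> bellZ j n m = 0.
Proof. by move=> mn; apply: wle_lt0 (bell_gr j n m); rewrite subr_lt0. Qed.

(** The value y(1): by [ys_lt] all terms with i >= l are zero, so the finite range contains the
    whole series. *)
Definition ysum a l := \sum_(i < l) ys i a l.

Lemma Yop_ysum F m K : (3%:Z * (m + 1) < K%:Z)%R -> gr 0 F ->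
  Yop ysum F m = \sum_(i < K) Yop (ys i) F m.
Proof.
move=> mK F0.
have h k : (K <= k)%N -> forall a, D (a, k) (F (m + 1)) = 0.
  move=> hk a; apply: (wle_D0 _ (F0 (m + 1))); rewrite w_b.
  by have := b_gt0 a; rewrite -mul2n => ?; nia.
under eq_bigr do rewrite (YopE _ h).
rewrite (YopE _ h) [RHS]exchange_big/=; apply: eq_bigr => k _.
rewrite [RHS]exchange_big/=; apply: eq_bigr => a _; rewrite -scaler_suml.
congr (_ *: _); rewrite /ysum.
rewrite [RHS](@sum_ord_null _ (fun i => ys i a k) k) ?(ltnW (ltn_ord k))//.
by move=> i ki; apply: ys_lt; lia.
Qed.

Lemma iter_Yop_ysum j m K : (3%:Z * m < K%:Z)%R ->
  iter j (Yop ysum) Z m = \sum_(n < K) bellZ j n m.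
Proof.
elim: j m K => [|j IH] m K mK.
  case: K mK => [|K] mK.
    rewrite big_ord0; apply: wle_lt0 (Z_wle m); exact: mK.
  by rewrite big_ord_recl/= big1 ?addr0// => n _; rewrite /bell/=.
(* [Yop] reads the coefficient at m + 1, where the weight bound has grown by 3. *)
pose M := (K + 3)%N.
have mM : (3%:Z * (m + 1) < M%:Z)%R by rewrite /M; lia.
transitivity (Yop ysum (\sum_(n < M) bellZ j n) m).
  have [K1 h1] := D_all_null (iter j (Yop ysum) Z (m + 1)).
  have e : (\sum_(n < M) bellZ j n) (m + 1) = iter j (Yop ysum) Z (m + 1).
    by rewrite (IH _ _ mM) fct_sumE.
  by rewrite iterS /Yop e.
rewrite (lin_sum (Yop_linear _)) fct_sumE.
have bell_gr0 n : gr 0 (bellZ j n).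
  move=> l; rewrite subr0; apply: wle_trans (bell_gr j n l).
  by rewrite gerBl.
under eq_bigr => n _ do rewrite (Yop_ysum mM (bell_gr0 n)).
rewrite exchange_big/=.
rewrite (triangle_sum (G := fun i n => Yop (ys i) (bellZ j n) m)); last first.
  move=> i n iM; apply: wle_lt0 (Yop_gr i (bell_gr j n) m).
  rewrite -!mul2n; lia.
rewrite -(@sum_ord_null _ (fun n => bellZ j.+1 n m) K M.+1).
- rewrite [RHS]big_ord_recl [X in _ = X + _](_ : _ = 0) ?add0r//.
  by apply: eq_bigr => n _; rewrite bellS/= fct_sumE.
- rewrite /M; lia.
- by move=> k Kk; apply: bell_vanish; rewrite -mul2n; lia.
Qed.

Lemma X_Yop i F : (fun m => LVtot (Yop (ys i) F m)) =
  Yop (ys i) (fun m => LVtot (F m)) + Yop (ys i.+1) F *+ i.+2.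
Proof.
rewrite -YopMn; apply/funext => m; rewrite LVtot_Yop; congr (_ + _).
by congr Yop; apply/funext => a; apply/funext => l; exact: ysS.
Qed.

(** [dpow_bell] equates the coefficients of every t^n. At a fixed power of hbar only finitely many n
    and j contribute, so summing over n sets t = 1 and the two summations may be exchanged. *)
Lemma exp_Yop_ysum m :
  \sum_(j \in [set: nat]%classic) (j`!%:R)^-1 *: iter j (Yop ysum) Z m =
  aexp LVtot (Z m).
Proof.
pose K := `|3%:Z * m|.+1.
have mK : (3%:Z * m < K%:Z)%R by rewrite /K; lia.
have Zm : wle W `|3%:Z * m|%:Z (Z m).
  by apply: wle_trans (Z_wle m); rewrite lez_abs.
rewrite (aexpE (F := wle W) (K := K) _ LVtot_linear (@LVsum_lowering _) Zm)//; last first.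
  exact: wle_lt0.
have XL : linear (fun (F : int -> V) m => LVtot (F m)).
  by move=> c F G; apply/funext => l; exact: LVtot_linear.
have iterX n : iter n (fun (F : int -> V) m => LVtot (F m)) Z m = iter n LVtot (Z m).
  by elim: n => //= n ->.
have dpowX n : dpow LVtot n (Z m) =
    \sum_(j < K) (j`!%:R)^-1 *: bellZ j n m.
  rewrite /dpow -iterX.
  have := @dpow_bell C _ (fun (F : int -> V) m => LVtot (F m)) (fun i => Yop (ys i))
    Z XL (fun i => Yop_linear (ys i)) (fun i j => Yop_comm (ys i) (ys j))
    X_Yop (funext LVtot_Z) n.
  move=> /(congr1 (fun F => F m)); rewrite {1}/dpow fct_sumE => e.
  transitivity (\sum_(j < n.+1) (j`!%:R)^-1 *: bellZ j n m); first exact: e.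
  have hn j : (n < j)%N -> (j`!%:R : C)^-1 *: bellZ j n m = 0.
    by move=> nj; rewrite bell_lt ?scaler0//; move=> i; exact: Yop_linear.
  have hK j : (K <= n)%N -> (j`!%:R : C)^-1 *: bellZ j n m = 0.
    by move=> Kn; rewrite bell_vanish ?scaler0// -mul2n; lia.
  have [nK|Kn] := ltnP n K.
    by rewrite [RHS](@sum_ord_null _ (fun j => (j`!%:R)^-1 *: bellZ j n m) n.+1).
  by rewrite !big1// => j _; exact: hK.
under [RHS]eq_bigr do rewrite dpowX.
rewrite exchange_big/= (@fsum_setT _ _ K).
  by apply: eq_bigr => j _; rewrite -scaler_sumr (iter_Yop_ysum _ mK).
move=> j Kj; rewrite (iter_Yop_ysum _ mK) big1 ?scaler0// => n _.
rewrite bell_lt//; first by move=> i; exact: Yop_linear.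
exact: leq_trans Kj.
Qed.

End Evaluation.

End VirasoroGroup.
End FockSpace.

(** * The quantized R-action and the initial cut-and-join operator *)

Section LinearSums.
Context {C : pzRingType} {U V : lmodType C}.

Lemma linear_sum_fun (J : Type) (s : seq J) (F : J -> U -> V) :
  (forall j, linear (F j)) -> linear (fun u => \sum_(j <- s) F j u).
Proof.
move=> FL c u v; rewrite scaler_sumr -big_split/=.
by apply: eq_bigr => j _; exact: FL.
Qed.

Lemma linear_add_fun (f g : U -> V) :
  linear f -> linear g -> linear (fun u => f u + g u).
Proof. by move=> fL gL c u v; rewrite fL gL scalerDr addrACA. Qed.
End LinearSums.

Lemma linear_scale_fun (C : fieldType) (U V : lmodType C) (x : C) (f : U -> V) :
  linear f -> linear (fun u => x *: f u).
Proof. by move=> fL c u v; rewrite fL scalerDr !scalerA mulrC. Qed.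

Section Quantization.
Context {C : numFieldType} {V : lmodType C} {N : nat}.
Context {X D : 'I_N * nat -> V -> V}.
Hypothesis X_linear : forall i, linear (X i).
Hypothesis D_linear : forall i, linear (D i).

Section RAction.
Context (W : weighting (X := X) (D := D) (fun i => i.2.*2.+1)).
Implicit Types (r : nat -> 'M[C]_N).

Definition Rterm r k p : V := \sum_(a < N) \sum_(b < N)
  (\sum_(j \in [set: nat]%classic) r k b a *: X (a, j) (D (b, (k + j)%N) p)
   + 2^-1 *: \sum_(j < k) ((-1) ^+ j.+1 * r k b a) *:
       D (a, (j : nat)) (D (b, (k - j - 1)%N) p)).

Definition RE r p := \sum_(k \in [set k : nat | (0 < k)%N]%classic) Rterm r k p.

Let D_null k b p : exists K, forall j, (K <= j)%N -> D (b, (k + j)%N) p = 0.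
Proof.
have [d hd] := win_bound W p; exists d => j dj.
by apply: (wle_D0 _ hd); rewrite /= ltz_nat -mul2n; lia.
Qed.

Lemma Rterm_linear r k : linear (Rterm r k).
Proof.
apply: linear_sum_fun => a; apply: linear_sum_fun => b; apply: linear_add_fun.
  apply: fsum_linear => [j c u v|p].
    by rewrite D_linear X_linear scalerDr !scalerA mulrC.
  have [K hK] := D_null k b p; exists K => j /hK ->.
  by rewrite (lin0 (X_linear _)) scaler0.
apply: linear_scale_fun; apply: linear_sum_fun => j; apply: linear_scale_fun.
by move=> c u v; rewrite !D_linear.
Qed.

(** Both T_j d/dT_(k+j) and the second derivatives of indices j and k - j - 1 lower the weight by
    2k, whichever families they belong to. *)
Lemma Rterm_wle r k d p : wle W d p -> wle W (d - k.*2%:Z) (Rterm r k p).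
Proof.
move=> dp; apply: win_sum => a _; apply: win_sum => b _; apply: winD.
  have [K hK] := D_null k b p.
  rewrite (@fsum_setT _ _ K) => [|j /hK ->]; last first.
    by rewrite (lin0 (X_linear _)) scaler0.
  apply: win_sum => j _; apply: winZ.
  apply: (win_X (Q := fun z => (z <= d - (k + j).*2.+1%:Z)%R)).
    by move=> z /=; rewrite -!mul2n; lia.
  exact: (wle_D (b, (k + j)%N) dp).
apply: winZ; apply: win_sum => j _; apply: winZ.
apply: wle_trans (wle_D (a, j : nat) (wle_D (b, (k - j - 1)%N) dp)) => /=.
by have := ltn_ord j; rewrite -!mul2n; lia.
Qed.

Lemma Rterm_null r : locally_null (Rterm r).
Proof.
move=> p; have [d hd] := win_bound W p; exists d.+1 => k dk.
by apply: wle_lt0 (Rterm_wle r k hd); rewrite -mul2n; lia.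
Qed.

Lemma RE_linear r : linear (RE r).
Proof.
by apply: fsum_linear => [k|]; [exact: Rterm_linear|exact: Rterm_null].
Qed.

Lemma RE_lowering r : lowering (wle W) (RE r).
Proof.
move=> d p dp; have [K hK] := Rterm_null r p.
rewrite /RE (@fsum_pos _ _ K) => [|k /ltnW/hK//].
apply: win_sum => k _; apply: wle_trans (Rterm_wle r k.+1 dp).
by rewrite -mul2n; lia.
Qed.

Lemma RE_opp r p : RE (fun k => - r k) p = - RE r p.
Proof.
have [K hK] := Rterm_null r p.
rewrite /RE (@fsum_map V V -%R _ (fun k => Rterm r k p) K)//; last first.
  by move=> s Q G; rewrite sumrN.
apply: eq_fsbigr => k _; rewrite /Rterm -sumrN; apply: eq_bigr => a _.
rewrite -sumrN; apply: eq_bigr => b _; rewrite opprD; congr (_ + _).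
  have [K' hK'] := D_null k b p.
  rewrite (@fsum_map V V -%R _
    (fun j => r k b a *: X (a, j) (D (b, (k + j)%N) p)) K') => [||j /hK' ->].
  - by apply: eq_fsbigr => j _; rewrite mxE scaleNr.
  - by move=> s Q G; rewrite sumrN.
  - by rewrite (lin0 (X_linear _)) scaler0.
rewrite -scalerN -sumrN; congr (_ *: _); apply: eq_bigr => j _.
by rewrite mxE mulrN scaleNr.
Qed.

Lemma aexp_RE_oppK r p : aexp (RE (fun k => - r k)) (aexp (RE r) p) = p.
Proof.
apply: (aexpNK (F := wle W)).
- by move=> d q; exact: wle_lt0.
- by move=> q; exact: win_bound.
- by move=> d; exact: win0.
- exact: RE_linear.
- exact: RE_linear.
- exact: RE_lowering.
- exact: RE_lowering.
- exact: RE_opp.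
Qed.

Lemma aexp_RE_linear r : linear (aexp (RE r)).
Proof.
apply: (aexp_linear (F := wle W)).
- by move=> d q; exact: wle_lt0.
- by move=> q; exact: win_bound.
- exact: RE_linear.
- exact: RE_lowering.
Qed.

Lemma aexp_RE_const r p : (forall i, D i p = 0) -> aexp (RE r) p = p.
Proof.
move=> D0; apply: aexp_fix; first exact: RE_linear.
apply: fsbig1 => k _; apply: big1 => a _; apply: big1 => b _.
rewrite fsbig1 ?add0r => [|j _]; last first.
  by rewrite D0 (lin0 (X_linear _)) scaler0.
by rewrite big1 ?scaler0// => j _; rewrite D0 (lin0 (D_linear _)) scaler0.
Qed.
End RAction.

(** * Virasoro constraints and the Euler operator *)

Section Constraints.
Context {w : 'I_N * nat -> nat} (W : weighting (X := X) (D := D) w).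
Context (b al : 'I_N -> nat) (s : 'I_N -> C) (Z : int -> V).
Hypothesis b_gt0 : forall a, (0 < b a)%N.
Hypothesis w_b : forall a k, w (a, k) = (b a * k.*2.+1)%N.
Hypothesis b_al : forall a, (b a * (al a).*2.+1 = 3)%N.
Hypothesis constraint : forall a (l : nat) m,
  s a *: (Lvir (X := X) (D := D) a (l%:Z - (al a)%:Z) (Z m)
          + ((l == al a)%:R / 8) *: Z m) =
  (dfact l.*2.+1)%:R *: D (a, l) (Z (m + 1)).

Let dfact_neq0 n : (dfact n)%:R != 0 :> C.
Proof. by rewrite pnatr_eq0 -lt0n dfact_gt0. Qed.

(** The degenerate case Delta_a = 0: the left side of the constraint vanishes and the double
    factorial is invertible. *)
Lemma D_Z_eq0 a l m : s a = 0 -> D (a, l) (Z m) = 0.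
Proof.
move=> sa; have := constraint a l (m - 1); rewrite sa scale0r subrK => /esym/eqP.
by rewrite scaler_eq0 (negPf (dfact_neq0 _)) => /eqP.
Qed.

(* When s a = 0, no variable of the family a occurs in Z and both sides vanish. *)
Lemma Lvir_Z a (k : nat) m : (0 < k)%N ->
  Lvir (X := X) (D := D) a k%:Z (Z m) =
    ((s a)^-1 * (dfact (k + al a).*2.+1)%:R) *: D (a, (k + al a)%N) (Z (m + 1)).
Proof.
move=> k0; have [sa|sa] := eqVneq (s a) 0.
  rewrite (D_Z_eq0 _ _ sa) scaler0 /Lvir /vir scaler0 add0r.
  rewrite fsbig1 => [|j _]; last first.
    by rewrite /= D_Z_eq0// (lin0 (X_linear _)) scaler0.
  rewrite big1 ?scaler0 ?addr0// => i _.
  by rewrite D_Z_eq0// (lin0 (D_linear _)) scaler0.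
have := constraint a (k + al a)%N m.
rewrite (_ : (k + al a)%N%:Z - (al a)%:Z = k%:Z); last by rewrite PoszD addrK.
rewrite (_ : (k + al a == al a)%N = false); last by lia.
rewrite mul0r scale0r addr0 => /(congr1 (fun p => (s a)^-1 *: p)).
by rewrite !scalerA mulVf// scale1r.
Qed.

Definition Wop p : V := \sum_(a < N) (s a / (al a).*2.+1%:R) *:
  \sum_(k \in [set: nat]%classic) ((dfact k.*2.-1)%:R)^-1 *:
    X (a, k) (Lvir (X := X) (D := D) a (k%:Z - (al a)%:Z) p
              + ((k == al a)%:R / 8) *: p).

(** By the constraints, the summand (a, k) is (2k+1)/(2 al a + 1) T^a_k d/dT^a_k of the next
    coefficient. Multiplication by 3 = b_a (2 al a + 1) turns these fractions into the weights b_a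
    (2k+1). Euler's identity enters as a hypothesis, an abstract space having no monomials. *)
Lemma Wop_Z m :
  (forall K, (forall k, (K <= k)%N -> forall a, D (a, k) (Z (m + 1)) = 0) ->
    \sum_(a < N) \sum_(k < K)
      (b a * k.*2.+1)%:R *: X (a, k : nat) (D (a, k : nat) (Z (m + 1))) =
    (3%:Z * (m + 1))%:~R *: Z (m + 1)) ->
  Wop (Z m) = (m + 1)%:~R *: Z (m + 1).
Proof.
move=> euler; have [K hK] := D_all_null W b_gt0 w_b (Z (m + 1)).
have n3 : 3%:R != 0 :> C by rewrite pnatr_eq0.
apply: (scalerI n3).
rewrite scalerA -[3%:R]/(3%:Z%:~R) -intrM -(euler K hK) /Wop scaler_sumr.
apply: eq_bigr => a _; have [sa|sa] := eqVneq (s a) 0.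
  rewrite sa mul0r scale0r scaler0 big1// => k _.
  by rewrite (D_Z_eq0 _ _ sa) (lin0 (X_linear _)) scaler0.
have e k : Lvir (X := X) (D := D) a (k%:Z - (al a)%:Z) (Z m)
    + ((k == al a)%:R / 8) *: Z m =
    ((s a)^-1 * (dfact k.*2.+1)%:R) *: D (a, k) (Z (m + 1)).
  by rewrite -[RHS]scalerA -constraint [RHS]scalerA mulVf// scale1r.
rewrite (@fsum_setT _ _ K) => [|k /hK h]; last first.
  by rewrite e h scaler0 (lin0 (X_linear _)) scaler0.
rewrite !scaler_sumr; apply: eq_bigr => k _.
rewrite e (linZ (X_linear _)) !scalerA; congr (_ *: _).
rewrite dfactS -(b_al a) !natrM.
have h1 := dfact_neq0 k.*2.-1.
have h2 : (al a).*2.+1%:R != 0 :> C by rewrite pnatr_eq0.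
by field; rewrite sa h1 nat1r h2.
Qed.
End Constraints.
End Quantization.

(** * Power series *)

(** An alias of the function type on which the ring product can be the Cauchy product instead of the
    pointwise one. *)
Definition pseries (C : Type) := nat -> C.

HB.instance Definition _ (C : fieldType) := GRing.Lmodule.copy (pseries C) (nat -> C^o).

Section PowerSeriesRing.
Context {C : fieldType}.
Implicit Types f g h : pseries C.

Lemma ps_mulC : commutative (ps_mul : pseries C -> pseries C -> pseries C).
Proof.
move=> f g; apply/funext => n; rewrite /ps_mul.
rewrite (sum_antidiag_sym (fun i j => f i * g j)).
by apply: eq_bigr => i _; rewrite mulrC.
Qed.

Lemma ps_mulA : associative (ps_mul : pseries C -> pseries C -> pseries C).
Proof.
move=> f g h; apply/funext => n.
rewrite [in RHS]ps_mulC /ps_mul.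
under [RHS]eq_bigr do rewrite big_distrr/=.
rewrite [RHS](sum_antidiagA (fun i j k => h i * (f j * g k))).
apply: eq_bigr => i _; rewrite big_distrr/=.
rewrite (sum_antidiag_sym (fun j k => f i * (g j * h k))).
by apply: eq_bigr => j _; rewrite [RHS]mulrC mulrA.
Qed.

Lemma ps_mul1 : left_id (ps_one : pseries C) ps_mul.
Proof.
move=> f; apply/funext => n; rewrite /ps_mul big_ord_recl/= mul1r subn0.
by rewrite big1 ?addr0// => i _; rewrite /ps_one/= mul0r.
Qed.

Lemma ps_mulDl : left_distributive (ps_mul : pseries C -> pseries C -> pseries C) +%R.
Proof.
move=> f g h; apply/funext => n.
transitivity (ps_mul f h n + ps_mul g h n); last by [].
by rewrite /ps_mul -big_split/=; apply: eq_bigr => i _; rewrite -mulrDl.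
Qed.

Lemma ps_one_neq0 : (ps_one : pseries C) != 0.
Proof.
by apply/eqP => /(congr1 (fun f => f 0%N)) /eqP; rewrite /ps_one/= oner_eq0.
Qed.

HB.instance Definition _ := GRing.Zmodule_isComNzRing.Build (pseries C)
  ps_mulA ps_mulC ps_mul1 ps_mulDl ps_one_neq0.

Lemma ps_scaleAl (c : C) f g : c *: (f * g) = (c *: f) * g.
Proof.
apply/funext => n; rewrite [RHS]/(ps_mul (c *: f) g n).
transitivity (c * ps_mul f g n); first by [].
by rewrite /ps_mul mulr_sumr; apply: eq_bigr => i _; rewrite mulrA.
Qed.

HB.instance Definition _ := GRing.Lmodule_isLalgebra.Build C (pseries C) ps_scaleAl.
HB.instance Definition _ := GRing.Lalgebra_isComAlgebra.Build C (pseries C).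

Lemma ps_mulE f g n : (f * g) n = \sum_(i < n.+1) f i * g (n - i)%N.
Proof. by []. Qed.

Lemma ps_addE f g n : (f + g) n = f n + g n. Proof. by []. Qed.
Lemma ps_scaleE c f n : (c *: f) n = c * f n. Proof. by []. Qed.

Lemma ps_sumE (J : Type) (r : seq J) (P : pred J) (F : J -> pseries C) n :
  (\sum_(j <- r | P j) F j) n = \sum_(j <- r | P j) F j n.
Proof. exact: (big_morph (fun f => f n)). Qed.

Lemma ps_mulrnE f k n : (f *+ k) n = f n *+ k.
Proof. by elim: k => [|k IH]; rewrite ?mulr0n// !mulrS ps_addE IH. Qed.

Lemma ps_expE (f : pseries C) j : ps_exp f j = f ^+ j.
Proof. by elim: j => [|j IH]; rewrite ?expr0// exprS -IH. Qed.

Definition order_ge (d : nat) f := forall n, (n < d)%N -> f n = 0.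

Lemma order_geM d e f g : order_ge d f -> order_ge e g -> order_ge (d + e) (f * g).
Proof.
move=> hf hg n nde; rewrite ps_mulE big1// => i _.
have [id|di] := ltnP i d; first by rewrite hf ?mul0r.
by rewrite hg ?mulr0//; have := ltn_ord i; lia.
Qed.

Lemma order_geX f j : order_ge 1 f -> order_ge j (f ^+ j).
Proof.
by move=> hf; elim: j => [//|j IH]; rewrite exprS -add1n; exact: order_geM.
Qed.

Lemma ps_mul_sum K n (F G : nat -> pseries C) :
  (n < K)%N -> (forall i, order_ge i (F i)) -> (forall i, order_ge i (G i)) ->
  \sum_(i < n.+1) (\sum_(k < K) F k i) * (\sum_(k < K) G k (n - i)%N) =
  \sum_(t < K) \sum_(k < t.+1) (F k * G (t - k)%N) n.
Proof.
move=> nK hF hG.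
transitivity (\sum_(k < K) \sum_(l < K) (F k * G l) n).
  under eq_bigr do rewrite big_distrlr/=.
  rewrite exchange_big/=; apply: eq_bigr => k _.
  by rewrite exchange_big/=; apply: eq_bigr => l _; rewrite ps_mulE.
rewrite (triangle_sum (G := fun k l => (F k * G l) n))// => k l Kkl.
exact: (order_geM (hF k) (hG l) (leq_trans nK Kkl)).
Qed.

Definition monom_ps m : pseries C := fun n => (n == m)%:R.

Lemma monom_psM m f n :
  (monom_ps m * f) n = if (m <= n)%N then f (n - m)%N else 0.
Proof.
rewrite ps_mulE; case: leqP => [mn|nm].
  rewrite (bigD1 (Ordinal (mn : (m < n.+1)%N)))//= /monom_ps eqxx mul1r.
  rewrite big1 ?addr0// => i im; rewrite (_ : (i == m :> nat) = false) ?mul0r//.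
  by apply: contraNF im => /eqP e; apply/eqP/val_inj.
rewrite big1// => i _; rewrite /monom_ps (_ : (i == m :> nat) = false) ?mul0r//.
by have := ltn_ord i; lia.
Qed.

Lemma monom_psX m : monom_ps 1 ^+ m = monom_ps m.
Proof.
elim: m => [|m IH]; first by rewrite expr0.
rewrite exprS IH; apply/funext => -[|n]; rewrite monom_psM//=.
by rewrite /monom_ps subSS subn0.
Qed.
End PowerSeriesRing.

Section BinomialSeries.
Context {C : numFieldType}.
Implicit Types (x : pseries C) (p q : C).

Definition gbin q j : C := (\prod_(i < j) (q - i%:R)) / j`!%:R.

Lemma gbin0 q : gbin q 0 = 1.
Proof. by rewrite /gbin big_ord0 fact0 divr1. Qed.

Lemma gbin1 q : gbin q 1 = q.
Proof. by rewrite /gbin big_ord1 subr0 factS fact0 mul1n divr1. Qed.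

Lemma gbinS q j : gbin q j.+1 *+ j.+1 = (q - j%:R) * gbin q j.
Proof.
rewrite /gbin big_ord_recr/= factS natrM -mulr_natr.
have h : j`!%:R != 0 :> C by rewrite pnatr_eq0 -lt0n fact_gt0.
have h' : j.+1%:R != 0 :> C by rewrite pnatr_eq0.
by field; rewrite h nat1r h'.
Qed.

(** Both sides satisfy the recursion of [gbinS] in n: the two factors produced by the product rule
    add up to (p - i) + (q - (n - i)) = p + q - n. *)
Lemma vandermonde p q n :
  \sum_(i < n.+1) gbin p i * gbin q (n - i)%N = gbin (p + q) n.
Proof.
elim: n => [|n IH]; first by rewrite big_ord1 !gbin0 mulr1.
have inj : injective (fun u : C => u *+ n.+1).
  by move=> u v /= /eqP; rewrite eqr_pMn2r// => /eqP.
apply: inj => /=; rewrite gbinS -IH.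
rewrite (cauchy_succ (fun i j => gbin p i * gbin q j)) -big_split mulr_sumr/=.
apply: eq_bigr => i _; rewrite -mulrnAl gbinS -mulrnAr gbinS.
rewrite natrB; last by rewrite -ltnS.
by ring.
Qed.

Definition pow1p q x : pseries C := ps_pow1p q x.

Lemma pow1pE q x K n : order_ge 1 x -> (n < K)%N ->
  pow1p q x n = \sum_(j < K) (gbin q j *: x ^+ j) n.
Proof.
move=> x1 nK; rewrite -[RHS](fsum_setT (F := fun j => (gbin q j *: x ^+ j) n)).
  rewrite (@fsum_setT _ _ n.+1).
    by apply: eq_bigr => j _; rewrite ps_expE.
  by move=> j nj; rewrite ps_scaleE (order_geX x1)// mulr0.
by move=> j Kj; rewrite ps_scaleE (order_geX x1) ?mulr0//; exact: leq_trans Kj.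
Qed.

Lemma pow1pD p q x : order_ge 1 x -> pow1p p x * pow1p q x = pow1p (p + q) x.
Proof.
move=> x1; apply/funext => n; rewrite ps_mulE.
have o r j : order_ge j (gbin r j *: x ^+ j).
  by move=> k kj; rewrite ps_scaleE (order_geX x1)// mulr0.
transitivity (\sum_(i < n.+1) (\sum_(k < n.+1) (gbin p k *: x ^+ k) i) *
    (\sum_(k < n.+1) (gbin q k *: x ^+ k) (n - i)%N)).
  apply: eq_bigr => i _; rewrite -(pow1pE _ x1 (ltn_ord i)).
  by rewrite -(pow1pE _ x1)// ltnS leq_subr.
rewrite (@ps_mul_sum _ n.+1 n (fun k => gbin p k *: x ^+ k)
  (fun k => gbin q k *: x ^+ k))// (pow1pE _ x1 (ltnSn n)).
apply: eq_bigr => t _; rewrite -vandermonde ps_scaleE mulr_suml.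
apply: eq_bigr => k _.
by rewrite -scalerAl -scalerAr scalerA -exprD subnKC -1?ltnS.
Qed.

Lemma pow1p0 x : pow1p 0 x = 1.
Proof.
apply/funext => n; rewrite /pow1p /ps_pow1p big_ord_recl big_ord0 fact0 divr1 mul1r.
rewrite big1 ?addr0// => j _.
by rewrite /bump/= big_ord_recl/= subr0 !mul0r.
Qed.

Lemma pow1p1 x : order_ge 1 x -> pow1p 1 x = 1 + x.
Proof.
move=> x1; apply/funext => n; rewrite (pow1pE _ x1 (leqnSn n.+1)).
rewrite big_ord_recl big_ord_recl/= big1 ?addr0; last first.
  move=> j _; rewrite ps_scaleE /gbin/= /bump/= !add1n big_ord_recl big_ord_recl/=.
  by rewrite subrr mul0r mulr0 !mul0r.
by rewrite !ps_scaleE gbin0 /bump/= addn0 gbin1 !mul1r expr0.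
Qed.

Lemma pow1pX q x m : order_ge 1 x -> pow1p q x ^+ m = pow1p (m%:R * q) x.
Proof.
move=> x1; elim: m => [|m IH]; first by rewrite mul0r pow1p0.
by rewrite exprS IH pow1pD// mulrS mulrDl mul1r.
Qed.
End BinomialSeries.

Section OddFlow.
Context {C : numFieldType}.
Implicit Types (c : nat -> C) (f g h : pseries C).

Lemma dpow_leibniz (A : comAlgType C) (d : A -> A) n p q : linear d ->
  (forall p q, d (p * q) = d p * q + p * d q) ->
  dpow d n (p * q) = \sum_(i < n.+1) dpow d i p * dpow d (n - i) q.
Proof.
move=> dL dM.
apply: (dpow_unique (E := fun n => \sum_(i < n.+1) dpow d i p * dpow d (n - i) q)
  dL) => [|{}n]; first by rewrite big_ord1 !dpow0.
rewrite (cauchy_succ (fun i j => dpow d i p * dpow d j q)) (lin_sum dL) -big_split.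
by apply: eq_bigr => i _; rewrite dM -mulrnAl -mulrnAr !dpowS.
Qed.

Definition euler_ps h : pseries C := fun n => n%:R * h n.

Lemma euler_psM f g : euler_ps (f * g) = euler_ps f * g + f * euler_ps g.
Proof.
apply/funext => n; rewrite /euler_ps ps_addE !ps_mulE -big_split mulr_sumr/=.
apply: eq_bigr => i _; rewrite -{1}(subnKC (_ : (i <= n)%N)) -1?ltnS// natrD.
by ring.
Qed.

Definition ovf c h : pseries C := odd_vf c h.

(** As z^(2k+1) d/dz = z^(2k) (z d/dz), the field is an even series times [euler_ps], hence a
    derivation. Truncation at K does not affect coefficients up to z^K. *)
Let symbol c K : pseries C := \sum_(k < K) c k.+1 *: monom_ps k.+1.*2.

Lemma ovfE c h n K : (n <= K)%N -> ovf c h n = (symbol c K * euler_ps h) n.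
Proof.
move=> nK; rewrite /ovf /odd_vf big_add1/= /symbol mulr_suml.
have -> : (\sum_(k < K) c k.+1 *: monom_ps k.+1.*2 * euler_ps h) n =
    \sum_(k < K) (c k.+1 *: (monom_ps k.+1.*2 * euler_ps h)) n.
  rewrite ps_sumE; apply: eq_bigr => k _.
  by rewrite -scalerAl.
rewrite big_mkcond big_mkord/=.
rewrite [RHS](sum_ord_null
  (F := fun k => (c k.+1 *: (monom_ps k.+1.*2 * euler_ps h)) n) nK).
  apply: eq_bigr => k _; rewrite ps_scaleE monom_psM /euler_ps.
  by case: ifP; rewrite ?mulr0// mulrA.
move=> k nk; rewrite ps_scaleE monom_psM ifF ?mulr0//.
by apply/negbTE; rewrite -ltnNge -mul2n; lia.
Qed.

Lemma ovf_linear c : linear (ovf c).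
Proof.
move=> x f g; apply/funext => n; rewrite ps_addE ps_scaleE !(@ovfE _ _ n n)//.
rewrite !ps_mulE mulr_sumr -big_split/=; apply: eq_bigr => i _.
by rewrite /euler_ps ps_addE ps_scaleE; ring.
Qed.

Lemma ovfM c f g : ovf c (f * g) = ovf c f * g + f * ovf c g.
Proof.
apply/funext => n; rewrite (@ovfE _ _ n n)// euler_psM mulrDr ps_addE.
rewrite mulrA (mulrCA _ f) [in RHS]ps_addE !ps_mulE; congr (_ + _).
  by apply: eq_bigr => i _; rewrite -ovfE// -ltnS.
by apply: eq_bigr => i _; rewrite -ovfE// leq_subr.
Qed.

Lemma ovf_order c h d : order_ge d h -> order_ge d.+2 (ovf c h).
Proof.
move=> hd n nd; rewrite /ovf /odd_vf big_nat_cond big1// => k.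
move=> /andP[/andP[k1 _] kn]; rewrite hd ?mulr0//; move: kn; rewrite -mul2n; lia.
Qed.

Lemma dpow_ovf_order c h d i : order_ge d h -> order_ge (d + i.*2) (dpow (ovf c) i h).
Proof.
move=> hd; suff o : order_ge (d + i.*2) (iter i (ovf c) h).
  by move=> n /o e; rewrite /dpow ps_scaleE e mulr0.
elim: i => [|i IH]; first by rewrite addn0.
by rewrite doubleS !addnS; exact: ovf_order.
Qed.

Lemma dpow_ovf_order_ge c h i : order_ge i (dpow (ovf c) i h).
Proof.
move=> n ni; apply: (@dpow_ovf_order c h 0 i) => //; rewrite -mul2n; lia.
Qed.

Definition expf c f : pseries C := fun n => \sum_(i < n.+1) dpow (ovf c) i f n.

Lemma expfE c f n K : (n < K)%N -> expf c f n = \sum_(i < K) dpow (ovf c) i f n.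
Proof.
move=> nK; rewrite [RHS](sum_ord_null (F := fun i => dpow (ovf c) i f n) nK)//.
by move=> k /dpow_ovf_order_ge.
Qed.

(** The exponential of a derivation is multiplicative; the flow of every power of z is thereby
    determined by the flow of z. *)
Lemma expfM c f g : expf c (f * g) = expf c f * expf c g.
Proof.
apply/funext => n; rewrite ps_mulE.
transitivity (\sum_(i < n.+1) (\sum_(k < n.+1) dpow (ovf c) k f i) *
    (\sum_(k < n.+1) dpow (ovf c) k g (n - i)%N)).
  rewrite (@ps_mul_sum _ n.+1 n (fun k => dpow (ovf c) k f)
    (fun k => dpow (ovf c) k g))//; try by move=> i; exact: dpow_ovf_order_ge.
  apply: eq_bigr => t _; rewrite dpow_leibniz ?ps_sumE//; first exact: ovf_linear.
  exact: ovfM.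
apply: eq_bigr => i _; rewrite -(expfE _ _ (ltn_ord i)).
by rewrite -(@expfE _ _ (n - i))// ltnS leq_subr.
Qed.

Lemma expf1 c : expf c 1 = 1.
Proof.
apply/funext => n; rewrite /expf big_ord_recl dpow0 big1 ?addr0// => i _.
have d1 : ovf c 1 = 0.
  have e1 : euler_ps 1 = 0 by apply/funext => -[|k]; [exact: mul0r|exact: mulr0].
  by apply/funext => k; rewrite (@ovfE _ _ k k)// e1 mulr0.
rewrite /dpow/= -iterS iterSr d1 (lin0 (iter_linear _ (ovf_linear c))) scaler0.
by [].
Qed.

Lemma expfX c f m : expf c (f ^+ m) = expf c f ^+ m.
Proof.
by elim: m => [|m IH]; rewrite ?expr0 ?expf1// !exprS expfM IH.
Qed.

Section Straightening.
Context (al : nat) (s : C) (DT chi : nat -> C).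
Hypothesis flow : forall n, odd_flow chi n = f_series al s DT n.

Let c k := - chi k.
Let m := al.*2.+1.

(** By multiplicativity the flow sends z^m to f(z)^m. The m-th root in the definition of f is
    undone, leaving z^m (1 - m v(z)/z^m), which is affine in v. *)
Lemma flow_monom n : expf c (monom_ps m) n =
  (n == m)%:R - m%:R * v_series al s DT n.
Proof.
pose x : pseries C := fun i => - (m%:R * v_series al s DT (i + m)%N).
have vm k : (k <= m)%N -> v_series al s DT k = 0.
  rewrite /m => km; rewrite /v_series ifF//; apply/negbTE/nandP; right.
  by rewrite -ltnNge; lia.
have x1 : order_ge 1 x by case=> // _; rewrite /x add0n vm// mulr0 oppr0.
have e : expf c (monom_ps 1) = monom_ps 1 * pow1p m%:R^-1 x.
  apply/funext => k; transitivity (odd_flow chi k); first by [].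
  rewrite flow monom_psM /f_series; case: k => //= k; rewrite subSS subn0//.
rewrite -monom_psX expfX e exprMn pow1pX// divff ?pnatr_eq0// pow1p1// mulrDr mulr1.
rewrite monom_psX ps_addE monom_psM {1}/monom_ps; congr (_ + _).
case: (leqP m n) => [mn|nm]; first by rewrite /x (subnK mn).
by rewrite vm ?mulr0 ?oppr0// ltnW.
Qed.

Let gs i := dpow (ovf c) i (monom_ps m).
Let si := s^-1.
Let chi' k := if k is 0%N then 0 else chi k.

(* The coefficient, in the variable T_l, of the term t^(i+1) of the solution
   - (exp(t Dv) z^m - z^m) / (s m) of y' = c + Dv y, where T_l corresponds to
   z^(2l+1) / (2l+1)!! and Dv = ovf c. *)
Definition ystep i l : C := - (si * (dfact l.*2.+1)%:R / m%:R) * gs i.+1 l.*2.+1.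

Lemma ovf_odd h l : ovf c h l.*2.+1 =
  - \sum_(j < l.+1) chi' (l - j)%N * j.*2.+1%:R * h j.*2.+1.
Proof.
rewrite big_ord_recr/= subnn !mul0r addr0 -sumrN /ovf /odd_vf.
rewrite big_add1/= big_mkcond (@big_cat_nat _ _ _ l)//=; last by rewrite -mul2n; lia.
rewrite [X in _ + X]big_nat_cond [X in _ + X]big1 ?addr0; last first.
  move=> k /andP[/andP[lk _] _]; rewrite ifF//; apply/negbTE; rewrite -ltnNge.
  by rewrite -!mul2n; lia.
rewrite big_mkord (reindex_inj rev_ord_inj)/=; apply: eq_bigr => j _.
have jl := ltn_ord j; rewrite ifT; last by rewrite -!mul2n; lia.
have -> : (l - j.+1).+1 = (l - j)%N by lia.
have -> : (l.*2.+1 - (l - j).*2 = j.*2.+1)%N by rewrite -!mul2n; lia.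
by rewrite /c /chi'; case e: (l - j)%N => [|k]; [lia|rewrite !mulNr].
Qed.

(** [Dv] applied to z^m has coefficient - m chi_k at z^(m+2k). The normalisation of [ystep] cancels
    - m and leaves the constants c dictated by the constraints. *)
Lemma ystep0 l : ystep 0 l =
  if (al < l)%N then si * (dfact l.*2.+1)%:R * chi' (l - al)%N else 0.
Proof.
have g1 : gs 1 = ovf c (monom_ps m) by rewrite /gs /dpow invr1 scale1r.
have m0 : m%:R != 0 :> C by rewrite pnatr_eq0.
rewrite /ystep g1 ovf_odd mulrN mulNr opprK.
have [all|lal] := ltnP al l.
  rewrite (bigD1 (Ordinal (leqW all : (al < l.+1)%N)))//= [X in _ + X]big1.
    rewrite addr0 /monom_ps eqxx mulr1 -[al.*2.+1]/m.
    by move: (m%:R : C) m0 => M M0; field; rewrite M0.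
  move=> j jal; rewrite /monom_ps eqSS (inj_eq double_inj).
  rewrite (_ : (j == al :> nat) = false) ?mulr0//.
  by apply: contraNF jal => /eqP e; apply/eqP/val_inj.
rewrite big1 ?mulr0// => j _; rewrite /monom_ps eqSS (inj_eq double_inj).
case: eqP => [e|_]; last by rewrite mulr0.
by rewrite (_ : l - j = 0)%N ?mul0r//; have := ltn_ord j; lia.
Qed.

(** This is the recursion of the divided powers of [Dv] in the basis z^(2j+1)/(2j+1)!!, where
    (2j+1)!! = (2j+1) (2j-1)!! turns the factor 2j+1 of the derivative into [vcoef]. *)
Lemma ystepS i l :
  - \sum_(j < l.+1) ystep i j * (chi' (l - j)%N * vcoef j (l - j)) =
  ystep i.+1 l *+ i.+2.
Proof.
rewrite /ystep -mulrnAr.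
have -> : gs i.+2 l.*2.+1 *+ i.+2 = ovf c (gs i.+1) l.*2.+1.
  by rewrite /gs -(dpowS _ _ (ovf_linear c)) ps_mulrnE.
rewrite ovf_odd mulrN mulNr opprK mulr_sumr -sumrN; apply: eq_bigr => j _.
rewrite /vcoef subnKC -1?ltnS// (dfactS j) natrM.
have h : (dfact j.*2.-1)%:R != 0 :> C by rewrite pnatr_eq0 -lt0n dfact_gt0.
by rewrite !mulNr opprK; field; rewrite h andbT pnatr_eq0.
Qed.

Lemma ystep_lt i l : (l < al + i.+1)%N -> ystep i l = 0.
Proof.
move=> li; rewrite /ystep /gs (@dpow_ovf_order c _ m i.+1) ?mulr0//.
  by move=> n nm; rewrite /monom_ps (ltn_eqF nm).
by rewrite /m -!mul2n; lia.
Qed.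

(** At t = 1 the series is - (f(z)^m - z^m)/(s m) = v(z)/s, whose coordinates are the [DT l]. The
    series v starts beyond z^m, so [DT] has to vanish up to [al]. *)
Lemma ystep_sum l : (forall k, (k <= al)%N -> DT k = 0) -> s != 0 ->
  \sum_(i < l) ystep i l = DT l.
Proof.
move=> DT0 s0; have [all|lal] := ltnP al l; last first.
  by rewrite DT0// big1// => i _; apply: ystep_lt; lia.
have ln : (l.+1 <= l.*2.+2)%N by rewrite -mul2n; lia.
have := flow_monom l.*2.+1.
rewrite /expf (sum_ord_null (F := fun i => dpow (ovf c) i (monom_ps m) l.*2.+1) ln).
  rewrite big_ord_recl dpow0 /= /v_series/= odd_double/= uphalf_double.
  rewrite ifT; last by rewrite -!mul2n; lia.
  (* The term of degree 0 in the flow is z^m itself and cancels on both sides. *)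
  move=> /addrI e; rewrite /ystep -mulr_sumr.
  rewrite -[X in _ * X]/(\sum_(i < l) dpow (ovf c) i.+1 (monom_ps m) l.*2.+1) e.
  have m0 : m%:R != 0 :> C by rewrite pnatr_eq0.
  have h : (dfact l.*2.+1)%:R != 0 :> C by rewrite pnatr_eq0 -lt0n dfact_gt0.
  rewrite [X in s * _ / X](_ : _ = (dfact l.*2.+1)%:R)//.
  by rewrite /si; field; rewrite s0 h m0.
move=> k kl; apply: (@dpow_ovf_order c _ m k).
  by move=> n nm; rewrite /monom_ps (ltn_eqF nm).
by rewrite /m -!mul2n; lia.
Qed.

End Straightening.
End OddFlow.

(** * Tau-functions *)

Section PolynomialFock.
Local Notation "1" := (@mone _) : monom_scope.
Local Notation "x * y" := (mmul x y) : monom_scope.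
Context {C : numFieldType} {I : choiceType}.
Implicit Types (p q : polyring C I) (i : I).

Definition pmul i p : polyring C I := pvar i * p.

Lemma pmul_linear i : linear (pmul i).
Proof. exact: pvarM_linear. Qed.

Lemma pmulC i j p : pmul i (pmul j p) = pmul j (pmul i p).
Proof. exact: (mulrCA (pvar i) (pvar j) p). Qed.

Lemma dpart_pmul i j p : dpart i (pmul j p) = p *+ (i == j) + pmul j (dpart i p).
Proof. exact: dpart_pvarM. Qed.

Definition malg_weighting (w : I -> nat) :
    weighting (V := polyring C I) (X := pmul) (D := dpart) w :=
  @Weighting C (polyring C I) I pmul dpart w (@weight_in C I w)
    (@weight_in0 C I w) (@weight_inD C I w) (@weight_inZ C I w)
    (@weight_inS C I w) (@weight_in_pvarM C I w) (@weight_in_dpart C I w)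
    (@weight_in_exists_bound C I w) (@weight_le_lt0 C I w).

(** In characteristic zero a non-constant monomial survives in the derivative along any of its
    variables. Homogeneity can thus be read off the derivatives, which are what the constraints
    provide. *)
Lemma weight_eq_dpart (w : I -> nat) (d : int) p : p@_(@mone _) = 0 ->
  (forall i, weight_in w (fun z => z = d - (w i)%:Z) (dpart i p)) ->
  weight_in w (fun z => z = d) p.
Proof.
move=> p1 hD m pm.
have [[i mi]|h] := EM (exists i, (0 < m i)%N); last first.
  case/eqP: pm; rewrite -p1; congr (_@__); apply/eqP/cmP => i; rewrite cm1.
  by apply/eqP; rewrite -leqn0 leqNgt; apply/negP => mi; apply: h; exists i.
have [m' e] := mulcm_ucm_gt0 mi; rewrite e mweight_ofM mweight_ofU PoszD.
rewrite (hD i m') ?subrK// mcoeff_dpart -e.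
by rewrite mulrn_eq0 negb_or pm.
Qed.

Lemma dpart_eq0_const p : (forall i, dpart i p = 0) -> p = (p@_(@mone _))%:MP.
Proof.
move=> h; apply/malgP => m; rewrite mcoeffC.
have [->|m1] := eqVneq m (@mone _); first by rewrite mulr1n.
rewrite mulr0n; have [[i mi]|hm] := EM (exists i, (0 < m i)%N); last first.
  case/eqP: m1; apply/eqP/cmP => i; rewrite cm1.
  by apply/eqP; rewrite -leqn0 leqNgt; apply/negP => mi; apply: hm; exists i.
have [m' e] := mulcm_ucm_gt0 mi; have := mcoeff_dpart i p m'.
by rewrite h mcoeff0 -e => /esym/eqP; rewrite mulrn_eq0 => /eqP.
Qed.
End PolynomialFock.

Section Euler.
Context {C : numFieldType} {N : nat} (b : 'I_N -> nat).
Let w (i : 'I_N * nat) : nat := (b i.1 * i.2.*2.+1)%N.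
Implicit Types (p : polyring C ('I_N * nat)%type).

Lemma mweight_of_pairs (m : cmonom ('I_N * nat)%type) K :
  (forall a k, (K <= k)%N -> m (a, k) = 0%N) ->
  mweight_of w m = (\sum_(a < N) \sum_(k < K) m (a, k : nat) * w (a, k : nat))%N.
Proof.
move=> h; rewrite /mweight_of.
transitivity (\sum_(i <- finsupp m) \sum_(a < N) \sum_(k < K)
    (if (a, k : nat) == i then m i * w i else 0))%N.
  apply: eq_big_seq => -[a k] im.
  have kK : (k < K)%N by rewrite ltnNge; apply: contraTN im => /h e; rewrite -cmE_eq0 e.
  rewrite (bigD1 a)//= (bigD1 (Ordinal kK))//= eqxx big1 ?addn0; last first.
    move=> j jk; rewrite xpair_eqE eqxx/= ifF//.
    by apply: contraNF jk => /eqP e; apply/eqP/val_inj.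
  rewrite big1 ?addn0// => c ca; rewrite big1// => j _.
  by rewrite xpair_eqE (negPf ca).
rewrite exchange_big/=; apply: eq_bigr => a _.
rewrite exchange_big/=; apply: eq_bigr => k _; rewrite -big_mkcond/=.
have [im|im] := boolP ((a, k : nat) \in finsupp m).
  rewrite -big_filter (perm_big [:: (a, k : nat)]) ?big_seq1//.
  apply: uniq_perm => // [|i]; first by rewrite filter_uniq ?fset_uniq.
  rewrite mem_filter inE eq_sym; case: eqP => [->|//]; by rewrite im.
rewrite (_ : m (a, k : nat) = 0%N); last by apply/eqP; rewrite cmE_eq0.
by rewrite mul0n big_seq_cond big1// => i /andP[ii /eqP e]; rewrite -e (negPf im) in ii.
Qed.

Lemma euler_pmul_dpart (d : int) p K :
  (forall k, (K <= k)%N -> forall a, dpart (a, k) p = 0) ->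
  weight_in w (fun z => z = d) p ->
  \sum_(a < N) \sum_(k < K)
    (b a * k.*2.+1)%:R *: pmul (a, k : nat) (dpart (a, k : nat) p) = d%:~R *: p.
Proof.
move=> h hp; apply/malgP => m; rewrite [RHS]mcoeffZ raddf_sum/=.
transitivity (\sum_(a < N) \sum_(k < K)
    ((m (a, k : nat) * w (a, k : nat))%N%:R * p@_m)).
  apply: eq_bigr => a _; rewrite raddf_sum/=; apply: eq_bigr => k _.
  rewrite [LHS]mcoeffZ /pmul mcoeff_pvar_dpart -[X in _ * X]mulr_natr.
  by rewrite [in RHS]natrM [RHS]mulrAC mulrC [in RHS](mulrC _%:R) /w.
have [->|pm] := eqVneq p@_m 0.
  by rewrite mulr0 big1// => a _; rewrite big1// => k _; rewrite mulr0.
rewrite -(hp _ pm) (@mweight_of_pairs m K).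
  rewrite -[X in _ = X * _]/((_)%N%:R) natr_sum mulr_suml; apply: eq_bigr => a _.
  by rewrite natr_sum mulr_suml.
move=> a k Kk; apply/eqP/negPn/negP; rewrite -lt0n => mi.
have [m' e] := mulcm_ucm_gt0 mi.
have := mcoeff_dpart (a, k) p m'; rewrite h// mcoeff0 -e => /esym/eqP.
by rewrite mulrn_eq0 (negPf pm).
Qed.
End Euler.

Lemma linear_comp (C : pzRingType) (U V T : lmodType C) (f : V -> T) (g : U -> V) :
  linear f -> linear g -> linear (fun u => f (g u)).
Proof. by move=> fL gL c u v; rewrite gL fL. Qed.

Lemma polyring_linear_ext (C : fieldType) (I : choiceType) (U : lmodType C)
    (f g : polyring C I -> U) : linear f -> linear g -> f 1 = g 1 ->
  (forall i p, f p = g p -> f (pvar i * p) = g (pvar i * p)) -> f =1 g.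
Proof.
move=> fL gL fg1 fgX p; elim/(@polyring_ind C I): p => [//|c p q hp hq|i p].
  by rewrite fL gL hp hq.
exact: fgX.
Qed.

Lemma mcoeff_linear (C : fieldType) (I : choiceType) (m : cmonom I) :
  linear (mcoeff m : polyring C I -> C^o).
Proof. by move=> c p q; rewrite mcoeffD mcoeffZ. Qed.

Section InFamily.
Local Notation "1" := (@mone _) : monom_scope.
Local Notation "x * y" := (mmul x y) : monom_scope.
Context {C : numFieldType} {N : nat}.
Implicit Types (a : 'I_N).
Local Notation P := (polyring C ('I_N * nat)%type).

Definition fam_monom a (m : cmonom nat) : P :=
  \prod_(k <- finsupp (cmonom_val m)) pvar (a, k) ^+ cmonom_val m k.

Lemma fam_monomEw a m (d : {fset nat}) : (finsupp (cmonom_val m) `<=` d)%fset ->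
  fam_monom a m = \prod_(k <- d) pvar (a, k) ^+ cmonom_val m k.
Proof.
move=> le; rewrite /fam_monom (big_fset_incl _ le)//= => i _.
by rewrite -cmE_eq0 => /eqP->; rewrite expr0.
Qed.

Lemma fam_monomM a m1 m2 :
  fam_monom a (m1 * m2)%M = fam_monom a m1 * fam_monom a m2.
Proof.
rewrite (@fam_monomEw a m1 (finsupp m1 `|` finsupp m2)%fset) ?fsubsetUl//.
rewrite (@fam_monomEw a m2 (finsupp m1 `|` finsupp m2)%fset) ?fsubsetUr//.
rewrite (@fam_monomEw a _ (finsupp m1 `|` finsupp m2)%fset) ?mdomD//.
by rewrite -big_split/=; apply: eq_bigr => i _; rewrite cmM exprD.
Qed.

Lemma fam_monom1 a : fam_monom a (@mone _) = 1.
Proof. by rewrite /fam_monom mdom1 big_seq_fset0. Qed.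

Lemma fam_monomU a k : fam_monom a (ucm k) = pvar (a, k).
Proof. by rewrite /fam_monom mdomU big_seq_fset1 cmUU expr1. Qed.

HB.instance Definition _ a := isMultiplicative.Build (cmonom nat) P (fam_monom a)
  (conj (fam_monomM a) (fam_monom1 a)).

(** [in_family] recast as the ring morphism T_k -> T^a_k, which gives its multiplicativity. *)
Definition fam_eval a : polyring C nat -> P := mmap (@malgC _ C) (fam_monom a).

Lemma in_familyE a p : in_family a p = fam_eval a p.
Proof.
by rewrite /fam_eval mmapE; apply: eq_bigr => m _; rewrite mul_malgC.
Qed.

Lemma fam_eval_linear a : linear (fam_eval a).
Proof.
move=> c p q; rewrite /fam_eval mmapD; congr (_ + _).
by rewrite mmapZ mul_malgC.
Qed.

Lemma fam_evalM a p q : fam_eval a (p * q) = fam_eval a p * fam_eval a q.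
Proof. exact: (rmorphM (mmap (@malgC _ C) (fam_monom a))). Qed.

Lemma fam_eval1 a : fam_eval a 1 = 1.
Proof. exact: (rmorph1 (mmap (@malgC _ C) (fam_monom a))). Qed.

Lemma fam_eval_pvar a k : fam_eval a (pvar k) = pvar (a, k).
Proof. by rewrite /fam_eval /pvar mmapU fam_monomU mul_malgC scale1r. Qed.

Lemma fam_eval_pmul a k p : fam_eval a (pmul k p) = pmul (a, k) (fam_eval a p).
Proof. by rewrite /pmul fam_evalM fam_eval_pvar. Qed.

Lemma dpart_fam_eval a c k p :
  dpart (c, k) (fam_eval a p) = (if c == a then fam_eval a (dpart k p) else 0).
Proof.
move: p; apply: (@polyring_linear_ext C nat P (fun p => dpart (c, k) (fam_eval a p))
  (fun p => if c == a then fam_eval a (dpart k p) else 0)).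
- exact: linear_comp (dpart_linear _) (fam_eval_linear a).
- case: (c == a); first exact: linear_comp (fam_eval_linear a) (dpart_linear k).
  by move=> x p q; rewrite scaler0 addr0.
- rewrite fam_eval1 !dpart1; case: ifP => // _.
  by rewrite (lin0 (fam_eval_linear a)).
- move=> j p hp; rewrite -/(pmul j p) fam_eval_pmul dpart_pmul hp xpair_eqE.
  have [_|_] := eqVneq c a; last by rewrite mulr0n add0r /pmul mulr0.
  rewrite (dpart_pmul k j) (linD (fam_eval_linear a)) fam_eval_pmul.
  by rewrite (linMn (fam_eval_linear a)).
Qed.

Lemma mcoeff1_fam_eval a p : (fam_eval a p)@_(@mone _) = p@_(@mone _).
Proof.
move: p; apply: (@polyring_linear_ext C nat C^o
  (fun p => (fam_eval a p)@_(@mone _)) (fun p => p@_(@mone _))).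
- exact: linear_comp (mcoeff_linear _) (fam_eval_linear a).
- exact: mcoeff_linear.
- by rewrite fam_eval1 !mcoeff1 !eqxx.
- by move=> j p hp; rewrite -/(pmul j p) fam_eval_pmul /pmul !mcoeff1_pvarM.
Qed.
End InFamily.

(** * Constraints of a product of tau-functions *)

Section ProductConstraint.
Context {C : numFieldType} {A : comAlgType C}.
Context (x : nat -> A) (D : nat -> A -> A).
Hypothesis D_linear : forall k, linear (D k).
Hypothesis D_leibniz : forall k p q, D k (p * q) = D k p * q + p * D k q.
Hypothesis D_null : locally_null D.
Implicit Types F G : nat -> A.

Let X k p := x k * p.

Let X_linear k : linear (X k).
Proof. by move=> c p q; rewrite /X mulrDr scalerAr. Qed.

Lemma vir_mulr m p q : (forall k, D k q = 0) -> vir X D m (p * q) = vir X D m p * q.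
Proof.
move=> Dq; apply/esym.
apply: (vir_intertwine (B := fun p => p * q) X_linear D_null).
- by move=> c u v; rewrite mulrDl -scalerAl.
- by move=> k u; rewrite /X mulrA.
- by move=> k u; rewrite D_leibniz Dq mulr0 addr0.
Qed.

(** The first clause is the constraint at hbar^-1, where only the derivative term remains. *)
Definition vir_constraint (s : C) (al : nat) F :=
  (forall k, D k (F 0%N) = 0) /\
  (forall l n, s *: (vir X D (l%:Z - al%:Z) (F n) + ((l == al)%:R / 8) *: F n) =
     (dfact l.*2.+1)%:R *: D l (F n.+1)).

(** A factor without variables of the family passes through the operators. In the coefficient of
    hbar^(n+1), the term containing F_0 has derivative zero, and the others match the terms of
    degree n. *)
Lemma vir_constraintM s al F G : vir_constraint s al F ->
  (forall k n, D k (G n) = 0) -> vir_constraint s al (ps_mul F G).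
Proof.
move=> [F0 FS] DG; split=> [k|l n].
  by rewrite /ps_mul big_ord1 D_leibniz F0 DG mul0r mulr0 addr0.
rewrite /ps_mul [in RHS]big_ord_recl/= (linD (D_linear l)) D_leibniz F0 DG mul0r mulr0.
rewrite add0r add0r (lin_sum (D_linear l)).
rewrite (lin_sum (vir_linear X_linear D_linear D_null _)).
rewrite !scaler_sumr -big_split !scaler_sumr/=; apply: eq_bigr => i _.
rewrite /bump/= add1n subSS D_leibniz DG mulr0 addr0 vir_mulr//.
by rewrite (scalerAl _ (F i)) -mulrDl scalerAl FS scalerAl.
Qed.

Lemma ps_mul_commA F G : ps_mul F G = ps_mul G F.
Proof.
apply/funext => n; rewrite /ps_mul (sum_antidiag_sym (fun i j => F i * G j)).
by apply: eq_bigr => i _; rewrite mulrC.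
Qed.

Lemma vir_constraintMr s al F G : vir_constraint s al G ->
  (forall k n, D k (F n) = 0) -> vir_constraint s al (ps_mul F G).
Proof. by move=> hG hF; rewrite ps_mul_commA; exact: vir_constraintM. Qed.

Lemma D_ps_mul_eq0 k F G n : (forall m, D k (F m) = 0) -> (forall m, D k (G m) = 0) ->
  D k (ps_mul F G n) = 0.
Proof.
move=> hF hG; rewrite /ps_mul (lin_sum (D_linear k)) big1// => i _.
by rewrite D_leibniz hF hG mul0r mulr0 addr0.
Qed.
End ProductConstraint.

Lemma constraint_normalize (C : numFieldType) (V : lmodType C) (a b c : V) (x y : C) :
  2^-1 *: a - (y / 2) *: c + (x / 16) *: b = 0 -> a + (x / 8) *: b = y *: c.
Proof.
have n2 : 2%:R != 0 :> C by rewrite pnatr_eq0.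
move=> h; apply: (scalerI (invr_neq0 n2)); apply/eqP; rewrite -subr_eq0; apply/eqP.
rewrite -[RHS]h scalerDr !scalerA -[RHS]addrAC; congr (_ + _ *: _ - _ *: _).
  by field.
exact: mulrC.
Qed.

(** Rescaling hbar by s multiplies the coefficient n by s^n; the derivative term sits one degree
    higher, which produces the factor s in front of the Virasoro operator. *)
Lemma constraint_rescale (C : numFieldType) (V : lmodType C) (u v t : V)
    (s x y : C) n : u + x *: v = y *: t ->
  s *: (s ^+ n *: u + x *: (s ^+ n *: v)) = y *: (s ^+ n.+1 *: t).
Proof.
move=> e; rewrite [RHS]scalerA mulrC -scalerA -e exprS -scalerA; congr (_ *: _).
by rewrite [RHS]scalerDr; congr (_ + _); rewrite !scalerA mulrC.
Qed.

Lemma linear_relation (C : fieldType) (U V : lmodType C) (f : U -> V) u v t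
    (x y : C) : linear f -> u + x *: v = y *: t -> f u + x *: f v = y *: f t.
Proof. by move=> fL e; rewrite -(linZ fL y) -e (linD fL) (linZ fL). Qed.

Lemma virasoroE (C : numFieldType) (I : choiceType) (x : nat -> I) m
    (p : polyring C I) :
  virasoro x m p = vir (fun k => pmul (x k)) (fun k => dpart (x k)) m p.
Proof.
rewrite /virasoro /vir.
have e1 n : \sum_(i < n.+1) ((dfact i.*2.-1 * dfact (n - i).*2.-1)%:R : C)^-1 *:
    (pvar (x i) * pvar (x (n - i)%N) * p) =
    \sum_(i < n.+1) ((dfact i.*2.-1 * dfact (n - i).*2.-1)%:R)^-1 *:
    pmul (x i) (pmul (x (n - i)%N) p).
  by apply: eq_bigr => i _; rewrite /pmul -(mulrA (pvar (x i))).
have e2 n : \sum_(i < n) (dfact i.*2.+1 * dfact (n - i.+1).*2.+1)%:R *: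
    pderiv (x i) (pderiv (x (n - i.+1)%N) p) =
    \sum_(i < n) (dfact i.*2.+1 * dfact (n - i.+1).*2.+1)%:R *:
    dpart (x i) (dpart (x (n - i.+1)%N) p).
  by apply: eq_bigr => i _; rewrite !pderivE.
have e3 : (fun k : nat => if k%:Z + m is Posz l then
      ((dfact l.*2.+1)%:R / (dfact k.*2.-1)%:R : C) *: (pvar (x k) * pderiv (x l) p)
    else 0) = (fun k : nat => if k%:Z + m is Posz l then
      ((dfact l.*2.+1)%:R / (dfact k.*2.-1)%:R : C) *: pmul (x k) (dpart (x l) p)
    else 0).
  by apply/funext => k; case: (k%:Z + m) => [l|l]; rewrite ?pderivE.
have e4 := congr1 (fun F : nat -> polyring C I =>
  \sum_(k \in [set: nat]%classic) F k) e3.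
case: m e4 {e3} => n e4.
  refine (f_equal2 +%R (f_equal2 +%R (erefl _) e4) _).
  exact: (congr1 (fun q => 2^-1 *: q) (e2 n)).
refine (f_equal2 +%R (f_equal2 +%R _ e4) (erefl _)).
exact: (congr1 (fun q => 2^-1 *: q) (e1 n)).
Qed.

Section DeltaTau.
Context {C : numFieldType} {N : nat}.
Local Notation P := (polyring C ('I_N * nat)%type).
Context (alpha : 'I_N -> 'I_2) (s : 'I_N -> C) (tau : 'I_2 -> nat -> polyring C nat).
Hypothesis tauP : forall al : 'I_2, is_tau al (tau al).

Definition tau_fam a : nat -> P :=
  fun n => s a ^+ n *: in_family a (tau (alpha a) n).

Local Notation cstr a := (vir_constraint (fun k => pvar (a, k) : P)
  (fun k => dpart (a, k)) (s a) (alpha a)).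

Let w1 (i : 'I_N * nat) := i.2.*2.+1.

Lemma dpart_fam_null a : locally_null (fun k => dpart (a, k) : P -> P).
Proof.
apply: (D_locally_null (malg_weighting w1) (x := fun k => (a, k)) (b := 1)) => // k.
by rewrite mul1n.
Qed.

Lemma dpart_nat_null : locally_null (dpart : nat -> polyring C nat -> polyring C nat).
Proof.
apply: (D_locally_null (malg_weighting (fun k : nat => k.*2.+1)) (x := id) (b := 1))
  => // k.
by rewrite mul1n.
Qed.

Lemma tau_constraint (al : 'I_2) (l n : nat) :
  vir pmul dpart (l%:Z - al%:Z) (tau al n) + ((l == al)%:R / 8) *: tau al n =
  (dfact l.*2.+1)%:R *: dpart l (tau al n.+1).
Proof.
have [_ /(_ l n%:Z)] := tauP al.
rewrite (_ : n%:Z + 1 = n.+1%:Z); last by rewrite -addn1 PoszD.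
rewrite virasoroE pderivE /to_laurent.
exact: constraint_normalize.
Qed.

Lemma dpart_tau0 (al : 'I_2) l : dpart l (tau al 0) = 0.
Proof.
(* At hbar^-1 the Virasoro terms act on 0 and only the derivative of the constant coefficient is
   left. *)
have [_ /(_ l (-1))] := tauP al; rewrite addNr /to_laurent virasoroE pderivE.
rewrite (lin0 (vir_linear (@pmul_linear C nat) (@dpart_linear C nat) dpart_nat_null _)).
rewrite !scaler0 sub0r addr0 => /eqP; rewrite oppr_eq0 scaler_eq0 mulf_eq0 invr_eq0.
by rewrite !pnatr_eq0 -leqn0 leqNgt dfact_gt0/= => /eqP.
Qed.

Lemma tau_fam_constraint a : cstr a (tau_fam a).
Proof.
split=> [k|l n]; rewrite /tau_fam !in_familyE.
  by rewrite (linZ (dpart_linear _)) dpart_fam_eval eqxx dpart_tau0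
    (lin0 (fam_eval_linear a)) scaler0.
set V := vir _ _ _.
have VL : linear V.
  apply: vir_linear => [k|k|].
  - exact: (@pvarM_linear C ('I_N * nat)%type (a, k)).
  - exact: dpart_linear.
  - exact: dpart_fam_null.
have VE p : V (fam_eval a p) = fam_eval a (vir pmul dpart (l%:Z - (alpha a)%:Z) p).
  apply/esym; apply: (vir_intertwine (B := fam_eval a) (@pmul_linear C nat)
    dpart_nat_null).
  - exact: fam_eval_linear.
  - by move=> k q; exact: fam_eval_pmul.
  - by move=> k q; rewrite dpart_fam_eval eqxx.
rewrite (linZ VL) VE (linZ (dpart_linear _)) dpart_fam_eval eqxx.
have L := @fam_eval_linear C N a.
exact: (constraint_rescale _ n (linear_relation L (tau_constraint (alpha a) l n))).
Qed.

Definition tau_prod (r : seq 'I_N) : nat -> P := \big[ps_mul/ps_one]_(a <- r) tau_fam a.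

Lemma dpart_tau_fam c a k n : c != a -> dpart (c, k) (tau_fam a n) = 0.
Proof.
move=> ca; rewrite /tau_fam in_familyE (linZ (dpart_linear _)) dpart_fam_eval.
by rewrite (negPf ca) scaler0.
Qed.

Lemma dpart_tau_prod r c k n : c \notin r -> dpart (c, k) (tau_prod r n) = 0.
Proof.
elim: r n => [|a r IH] n cr; rewrite /tau_prod.
  rewrite big_nil /ps_one; case: n => [|n]; first exact: dpart1.
  exact: (lin0 (dpart_linear _)).
move: cr; rewrite inE negb_or big_cons => /andP[ca cr].
apply: (@D_ps_mul_eq0 C P (fun k => dpart (c, k))).
- by move=> j; exact: dpart_linear.
- by move=> j p q; exact: dpartM.
- by move=> m; exact: dpart_tau_fam.
- by move=> m; exact: IH.
Qed.

Lemma tau_prod_constraint r a : uniq r -> a \in r -> cstr a (tau_prod r).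
Proof.
elim: r => [//|c r IH] /= /andP[cr ur]; rewrite inE /tau_prod big_cons.
have DL c' k : linear (dpart (c', k) : P -> P) by exact: dpart_linear.
have DM c' k (p q : P) :
    dpart (c', k) (p * q) = dpart (c', k) p * q + p * dpart (c', k) q.
  exact: dpartM.
have [->|ac /= ar] := eqVneq a c.
  move=> _; refine (vir_constraintM (DL c) (DM c) (@dpart_fam_null c)
    (tau_fam_constraint c) _).
  by move=> k n; exact: dpart_tau_prod.
refine (vir_constraintMr (DL a) (DM a) (@dpart_fam_null a) (IH ur ar) _).
by move=> k n; exact: dpart_tau_fam.
Qed.

Lemma mcoeff1M (p q : P) : (p * q)@_(@mone _) = p@_(@mone _) * q@_(@mone _).
Proof. exact: (rmorphM (mcoeff (@mone _) : P -> C)). Qed.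

Lemma mcoeff1_tau_prod r n : (tau_prod r n)@_(@mone _) = (n == 0%N)%:R.
Proof.
elim: r n => [|a r IH] n; rewrite /tau_prod.
  rewrite big_nil /ps_one; case: n => [|n].
    by rewrite mcoeff1 eqxx.
  exact: mcoeff0.
rewrite big_cons -/(tau_prod r) /ps_mul raddf_sum/=.
transitivity (\sum_(i < n.+1) ((i : nat) == 0%N)%:R * ((n - i)%N == 0%N)%:R : C).
  apply: eq_bigr => i _; rewrite mcoeff1M IH; congr (_ * _).
  rewrite /tau_fam in_familyE mcoeffZ mcoeff1_fam_eval.
  have [-> _] := tauP (alpha a).
  by case: (i : nat) => [|j]; rewrite ?mulr0// expr0 mul1r.
rewrite big_ord_recl/= subn0 mul1r big1 ?addr0// => i _.
by rewrite mul0r.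
Qed.
End DeltaTau.

(** * The ancestor potential *)

Lemma fsum_pos_setT (V : zmodType) (F : nat -> V) : F 0%N = 0 ->
  \sum_(k \in [set k : nat | (0 < k)%N]%classic) F k =
  \sum_(k \in [set: nat]%classic) F k.
Proof.
move=> F0; apply: fsbig_widen => // k [_ /= /negP]; rewrite -leqNgt leqn0.
by move=> /eqP->.
Qed.

Section FockAssembly.
Context {C : numFieldType} {V : lmodType C} {N : nat}.
Context {X D : 'I_N * nat -> V -> V}.
Hypothesis X_linear : forall i, linear (X i).
Hypothesis D_linear : forall i, linear (D i).
Hypothesis D_comm : forall i j p, D i (D j p) = D j (D i p).
Context {w : 'I_N * nat -> nat} (W : weighting (X := X) (D := D) w).
Context (b : 'I_N -> nat).
Hypothesis b_gt0 : forall a, (0 < b a)%N.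
Hypothesis w_b : forall a k, w (a, k) = (b a * k.*2.+1)%N.

Lemma LV_opp chi a p :
  LV (X := X) (D := D) (fun c k => - chi c k) a p = - LV (X := X) (D := D) chi a p.
Proof.
have [K hK] := Lvir_null X_linear W b_gt0 w_b a p.
rewrite /LV (@fsum_map V V -%R _
  (fun k => chi a k *: Lvir (X := X) (D := D) a k%:Z p) K).
- by apply: eq_fsbigr => k _; rewrite scaleNr.
- by move=> s Q G; rewrite sumrN.
- by move=> k /hK ->; rewrite scaler0.
Qed.

Lemma D_Yop_eq0 i y F m : (forall n, D i (F n) = 0) -> D i (Yop (D := D) y F m) = 0.
Proof.
move=> h; have [K hK] := D_all_null W b_gt0 w_b (F (m + 1)).
rewrite (YopE _ hK) (lin_sum (D_linear i)) big1// => k _.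
rewrite (lin_sum (D_linear i)) big1// => a _.
by rewrite (linZ (D_linear i)) D_comm h (lin0 (D_linear _)) scaler0.
Qed.

(** Translations preserve the absence of the variables of a dead family, so their components along
    it never act. *)
Lemma iter_Yop_eq (dead : 'I_N -> bool) y y' Z j :
  (forall a k m, dead a -> D (a, k) (Z m) = 0) ->
  (forall a k, ~~ dead a -> y a k = y' a k) ->
  iter j (Yop (D := D) y) Z = iter j (Yop (D := D) y') Z.
Proof.
move=> Z0 yy.
have DZ i a k m : dead a -> D (a, k) (iter i (Yop (D := D) y') Z m) = 0.
  move=> da; elim: i m => [|i IH] m /=; first exact: Z0.
  exact: D_Yop_eq0.
elim: j => //= j ->; apply/funext => m; apply: eq_fsbigr => k _.
apply: eq_bigr => a _; have [da|da] := boolP (dead a); last by rewrite yy.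
by rewrite DZ// !scaler0.
Qed.
End FockAssembly.

Lemma conjugated_recursion (C : fieldType) (V : lmodType C)
    (Rf Rb Vf Vb Wf : V -> V) (z0 z1 : V) (c : C) :
  linear Rf -> linear Vf -> cancel Rf Rb -> cancel Vf Vb ->
  Wf z0 = c *: z1 -> c != 0 ->
  Rf (Vf z1) = c^-1 *: Rf (Vf (Wf (Vb (Rb (Rf (Vf z0)))))).
Proof.
move=> RL VL RK VK e c0.
by rewrite RK VK e (linZ VL) (linZ RL) scalerA mulVf// scale1r.
Qed.

Section Ancestor.
Context {C : numFieldType} {N : nat}.
Local Notation P := (polyring C ('I_N * nat)%type).
Local Notation XP := (@pmul C ('I_N * nat)%type).
Local Notation DP := (@dpart C ('I_N * nat)%type).
Context (alpha : 'I_N -> 'I_2) (s : 'I_N -> C) (tau : 'I_2 -> nat -> polyring C nat).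
Hypothesis tauP : forall al : 'I_2, is_tau al (tau al).

Let al a : nat := alpha a.
(** The number 3 is the least common multiple of the values 1 and 3 of 2 alpha + 1; this makes the
    weights integral. *)
Let b a : nat := if al a is 0%N then 3%N else 1%N.
Let w (i : 'I_N * nat) : nat := (b i.1 * i.2.*2.+1)%N.
Let Zn : nat -> P := tau_prod alpha s tau (index_enum 'I_N).
Let Z : int -> P := to_laurent Zn.

Let b_gt0 a : (0 < b a)%N. Proof. by rewrite /b; case: (al a). Qed.

Let w_b a k : w (a, k) = (b a * k.*2.+1)%N. Proof. by []. Qed.

Let b_al a : (b a * (al a).*2.+1 = 3)%N.
Proof. by rewrite /b /al; case: (alpha a) => -[|[|]]. Qed.

Let W := malg_weighting (C := C) w.
Let W1 := malg_weighting (C := C) (fun i : 'I_N * nat => i.2.*2.+1).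

Let X_linear (i : 'I_N * nat) : linear (XP i). Proof. exact: pmul_linear. Qed.
Let D_linear (i : 'I_N * nat) : linear (DP i). Proof. exact: dpart_linear. Qed.
Let X_comm (i j : 'I_N * nat) p : XP i (XP j p) = XP j (XP i p).
Proof. exact: pmulC. Qed.
Let D_comm (i j : 'I_N * nat) p : DP i (DP j p) = DP j (DP i p).
Proof. exact: dpartC. Qed.
Let D_X (i j : 'I_N * nat) p : DP i (XP j p) = p *+ (i == j) + XP j (DP i p).
Proof. exact: dpart_pmul. Qed.

Let Zn_constraint a : vir_constraint (fun k => pvar (a, k) : P)
  (fun k => DP (a, k)) (s a) (al a) Zn.
Proof. exact: tau_prod_constraint (index_enum_uniq _) (mem_index_enum a). Qed.

Lemma Z_constraint a (l : nat) m :
  s a *: (Lvir (X := XP) (D := DP) a (l%:Z - (al a)%:Z) (Z m)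
          + ((l == al a)%:R / 8) *: Z m) =
  (dfact l.*2.+1)%:R *: DP (a, l) (Z (m + 1)).
Proof.
have [h0 hS] := Zn_constraint a.
have L0 := lin0 (Lvir_linear X_linear D_linear W b_gt0 w_b a (l%:Z - (al a)%:Z)).
case: m => [n|[|n]].
- rewrite (_ : n%:Z + 1 = n.+1%:Z); last by rewrite -addn1 PoszD.
  exact: hS.
(* At m = -1 the right side is a derivative of Z_0, which is constant. *)
- rewrite [Z _]/(0 : P) L0 scaler0 addr0 scaler0.
  by rewrite [Z _]/(Zn 0) h0 scaler0.
- rewrite [Z (Negz n.+1)]/(0 : P) L0 scaler0 addr0 scaler0.
  by rewrite [Z _]/(0 : P) (lin0 (D_linear _)) scaler0.
Qed.

Let dpart_Zn0 i : DP i (Zn 0) = 0.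
Proof. by case: i => a k; have [h0 _] := Zn_constraint a. Qed.

Lemma Zn0 : Zn 0 = 1.
Proof. by rewrite [LHS](dpart_eq0_const dpart_Zn0) mcoeff1_tau_prod. Qed.

Lemma Zn_homogeneous n : weight_in w (fun z => z = (3 * n)%N%:Z) (Zn n).
Proof.
elim: n => [|n IH].
  rewrite Zn0 => m; rewrite mcoeff1.
  case: (eqVneq m (@mone _)) => [->|_]; last by rewrite eqxx.
  by rewrite mweight_of1.
apply: weight_eq_dpart => [|[a l]].
  by rewrite mcoeff1_tau_prod.
have [_ /(_ l n) e] := Zn_constraint a.
have h : (dfact l.*2.+1)%:R != 0 :> C by rewrite pnatr_eq0 -lt0n dfact_gt0.
have -> : DP (a, l) (Zn n.+1) = ((dfact l.*2.+1)%:R)^-1 *: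
    ((dfact l.*2.+1)%:R *: DP (a, l) (Zn n.+1)).
  exact: (esym (scalerK h _)).
rewrite -e; apply: weight_inZ; apply: weight_inZ; apply: weight_inD.
  refine (win_vir (W := W) (b_gt0 a) X_linear (w_b a) _ IH) => z ->.
  (* The equality needed is 3n - 2b (l - al) = 3(n+1) - b (2l+1), that is b (2 al + 1) = 3. *)
  rewrite w_b; have := b_al a; rewrite -!mul2n; nia.
(* The constant 1/8 appears only at l = al, where T_l has weight exactly 3. *)
case: eqP => [->|_]; last by rewrite mul0r scale0r; exact: weight_in0.
apply: weight_inZ; apply: weight_inS IH => z ->.
by rewrite w_b b_al; lia.
Qed.

Let Z_wle m : wle W (3%:Z * m) (Z m).
Proof.
case: m => n; last exact: weight_in0.
by apply: weight_inS (Zn_homogeneous (n := n)) => z ->; rewrite PoszM.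
Qed.

Lemma W_Delta_Z n : W_Delta alpha s (Zn n) = n.+1%:R *: Zn n.+1.
Proof.
have h := @Wop_Z C P N XP DP X_linear w W b al s Z b_gt0 w_b b_al
  Z_constraint n%:Z.
have e1 : n%:Z + 1 = n.+1%:Z by rewrite -addn1 PoszD.
rewrite e1 in h.
transitivity (Wop (X := XP) (D := DP) al s (Zn n)); last first.
  apply: h => K hK; rewrite (euler_pmul_dpart hK (Zn_homogeneous (n := n.+1))).
  by rewrite PoszM.
rewrite /W_Delta /Wop; apply: eq_bigr => a _.
refine (congr1 (fun q : P => (s a / (al a).*2.+1%:R) *: q) _).
apply: eq_fsbigr => k _.
exact: (congr1 (fun q : P => ((dfact k.*2.-1)%:R)^-1 *:
  (pvar (a, k) * (q + ((k == al a)%:R / 8) *: Zn n)))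
  (virasoroE (fun i => (a, i)) (k%:Z - (al a)%:Z) (Zn n))).
Qed.

Section Straightened.
Context (DT chi : 'I_N -> nat -> C).
Hypothesis DT_0 : forall a, DT a 0%N = 0.
Hypothesis DT_1 : forall a, alpha a = 1%N :> nat -> DT a 1%N = 0.
Hypothesis chiP : forall a n, odd_flow (chi a) n = f_series (alpha a) (s a) (DT a) n.

Let chi' a k := if k is 0%N then 0 else chi a k.
Let chi'0 a : chi' a 0%N = 0. Proof. by []. Qed.
Let ys i a l := ystep (al a) (s a) (chi a) i l.

Lemma T_exponentE : T_exponent DT = Yop (D := DP) DT.
Proof.
apply/funext => F; apply/funext => m.
pose G (k : nat) := \sum_(a < N) DT a k *: DP (a, k) (F (m + 1)).
have G0 : G 0%N = 0 by apply: big1 => a _; rewrite DT_0; exact: scale0r.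
apply: etrans (fsum_pos_setT G0).
apply: eq_fsbigr => k _; apply: eq_bigr => a _.
exact: (congr1 (fun q : P => DT a k *: q) (pderivE _ _)).
Qed.

Lemma T_hat_Z m : T_hat DT Z m = aexp (LVtot (X := XP) (D := DP) chi') (Z m).
Proof.
have ys0 a l : ys 0 a l = if (al a < l)%N then
    (s a)^-1 * (dfact l.*2.+1)%:R * chi' a (l - al a)%N else 0.
  exact: ystep0.
have ysS i a l : Aop chi' (ys i) a l = ys i.+1 a l *+ i.+2 by exact: ystepS.
have ys_lt i a l : (l < al a + i.+1)%N -> ys i a l = 0 by exact: ystep_lt.
have L_Z := @Lvir_Z C P N XP DP X_linear D_linear al s Z Z_constraint.
have := @exp_Yop_ysum C P N XP DP X_linear D_linear D_comm D_X w W b b_gt0 w_b chi'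
  chi'0 al (fun a => (s a)^-1) Z b_al Z_wle L_Z ys ys0 ysS ys_lt m.
move=> h; apply: etrans h; rewrite /T_hat T_exponentE; apply: eq_fsbigr => j _.
(* If sqrt(Delta_a) = 0, its inverse is 0 by convention and [ysum] is zero on that family whatever
   [DT] is; the two translations still agree on Z. *)
have e := @iter_Yop_eq C P N XP DP D_linear D_comm w W b b_gt0 w_b
  (fun a => s a == 0) DT (ysum ys) Z j.
have e' : iter j (Yop (D := DP) DT) Z = iter j (Yop (D := DP) (ysum ys)) Z.
  apply: e => [a k n /eqP sa|a l sa].
    exact: (D_Z_eq0 Z_constraint).
  rewrite /ysum; apply/esym; apply: (ystep_sum (chiP a)) => // k.
  have := DT_1 (a := a); rewrite /al; case: (alpha a) => -[|[|//]] i1 /= h.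
    by rewrite leqn0 => /eqP->.
  by case: k => [|[|//]] // _; exact: h.
exact: (congr1 (fun F : int -> P => (j`!%:R)^-1 *: F m) e').
Qed.
End Straightened.

Lemma V_hatE (chi : 'I_N -> nat -> C) p : V_hat chi p =
  aexp (LVtot (X := XP) (D := DP) (fun a k => if k is 0%N then 0 else chi a k)) p.
Proof.
set c' := (fun a k => _).
have h := aexp_LVsum X_linear D_linear X_comm D_comm D_X W b_gt0 w_b (chi := c')
  (fun=> erefl) (index_enum 'I_N) p.
apply: etrans (esym h); rewrite /V_hat.
refine (congr1 (fun f : P -> P => f p) (eq_bigr _ _)) => a _.
refine (congr1 (@aexp C P) _); apply/funext => q.
have G0 : c' a 0%N *: Lvir (X := XP) (D := DP) a 0%N q = 0 by exact: scale0r.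
apply: etrans (fsum_pos_setT (F := fun k : nat =>
  c' a k *: Lvir (X := XP) (D := DP) a k%:Z q) G0).
apply: eq_fsbigr => k /set_mem; case: k => [k0|k _]; first by case: (notF k0).
exact: (congr1 (fun t : P => chi a k.+1 *: t) (virasoroE _ _ _)).
Qed.

Lemma R_hatE (r : nat -> 'M[C]_N) : R_hat r = aexp (RE (X := XP) (D := DP) r).
Proof.
refine (congr1 (@aexp C P) _); apply/funext => p; apply: eq_fsbigr => k _.
apply: eq_bigr => a _; apply: eq_bigr => c _.
refine (f_equal2 +%R _ _).
  apply: eq_fsbigr => j _.
  exact: (congr1 (fun t : P => r k c a *: (pvar (a, j) * t)) (pderivE _ _)).
refine (congr1 (fun t : P => 2^-1 *: t) _); apply: eq_bigr => j _.
by rewrite !pderivE.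
Qed.

Lemma R_hat_linear (r : nat -> 'M[C]_N) : linear (R_hat r : P -> P).
Proof. by rewrite R_hatE; exact: (aexp_RE_linear X_linear D_linear W1). Qed.

Lemma R_hatK (r : nat -> 'M[C]_N) : cancel (R_hat r : P -> P) (R_hat (fun k => - r k)).
Proof. by move=> p; rewrite !R_hatE; exact: (aexp_RE_oppK X_linear D_linear W1). Qed.

Lemma R_hat1 (r : nat -> 'M[C]_N) : R_hat r (1 : P) = 1.
Proof.
rewrite R_hatE; apply: (aexp_RE_const X_linear D_linear W1) => i; exact: dpart1.
Qed.

Let wle_neg d (p : P) : d < 0 -> wle W d p -> p = 0.
Proof. exact: wle_lt0. Qed.

Let wle_exists (p : P) : exists d : nat, wle W d%:Z p.
Proof. exact: win_bound. Qed.

Let LVc (chi : 'I_N -> nat -> C) :=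
  LVtot (X := XP) (D := DP) (fun a k => if k is 0%N then 0 else chi a k).

Let LVc_linear chi : linear (LVc chi).
Proof. exact: (LVsum_linear X_linear D_linear W b_gt0 w_b). Qed.

Let LVc_lowering chi : lowering (wle W) (LVc chi).
Proof. exact: (LVsum_lowering X_linear b_gt0 w_b). Qed.

Lemma V_hat_linear chi : linear (V_hat chi : P -> P).
Proof.
have -> : V_hat chi = aexp (LVc chi) by apply/funext => p; exact: V_hatE.
exact: (aexp_linear wle_neg wle_exists (LVc_linear chi) (LVc_lowering (chi := chi))).
Qed.

Lemma V_hatK chi : cancel (V_hat chi : P -> P) (V_hat (fun a k => - chi a k)).
Proof.
move=> p; rewrite !V_hatE.
refine (aexpNK wle_neg wle_exists p (fun d => win0 W _)
  (LVc_linear (fun a k => - chi a k))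
  (LVc_linear chi) (LVc_lowering (chi := fun a k => - chi a k))
  (LVc_lowering (chi := chi)) _) => q.
rewrite /LVc (_ : (fun a k => _) =
  (fun a k => - (if k is 0%N then 0 else chi a k))).
  rewrite /LVtot /LVsum -sumrN; apply: eq_bigr => a _.
  exact: (LV_opp X_linear W b_gt0 w_b).
by apply/funext => a; apply/funext => -[|k] //; rewrite oppr0.
Qed.

Lemma V_hat1 chi : V_hat chi (1 : P) = 1.
Proof.
rewrite V_hatE; apply: (aexp_fix (LVc_linear chi)).
(* The polynomial 1 = Z_0 has weight 0, so a lowering operator sends it to negative weight, hence to
   0. *)
have h := @Z_wle (Posz 0); rewrite mulr0 (Zn0 : Z (Posz 0) = 1) in h.
exact: (wle_neg _ (LVc_lowering h)).
Qed.

Section Recursion.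
Context (r : nat -> 'M[C]_N) (DT chi : 'I_N -> nat -> C).
Hypothesis DT_0 : forall a, DT a 0%N = 0.
Hypothesis DT_1 : forall a, alpha a = 1%N :> nat -> DT a 1%N = 0.
Hypothesis chiP : forall a n, odd_flow (chi a) n = f_series (alpha a) (s a) (DT a) n.

(** R and V do not involve hbar and act on each coefficient separately; the negative powers of hbar
    formally present in the translation thus have coefficient zero. *)
Lemma ancestorE m : ancestor alpha r DT s tau m = R_hat r (V_hat chi (Z m)).
Proof.
rewrite /ancestor; congr (R_hat r _).
exact: (etrans (T_hat_Z DT_0 DT_1 chiP m) (esym (V_hatE chi (Z m)))).
Qed.

Lemma ancestor_recursion :
  [/\ forall n : nat, ancestor alpha r DT s tau (- n.+1%:Z) = 0,
      ancestor alpha r DT s tau 0 = 1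
    & forall k : nat, (1 <= k)%N -> ancestor alpha r DT s tau k%:Z =
        k%:R^-1 *: cut_and_join alpha r s chi (ancestor alpha r DT s tau (k.-1)%:Z)].
Proof.
split=> [n||[//|k] _]; rewrite ancestorE.
- rewrite [Z _]/(0 : P) (lin0 (V_hat_linear chi)).
  exact: (lin0 (R_hat_linear r)).
- by rewrite (Zn0 : Z 0 = 1) V_hat1 R_hat1.
- rewrite ancestorE; have k0 : k.+1%:R != 0 :> C by rewrite pnatr_eq0.
  exact: (conjugated_recursion (R_hat_linear r) (V_hat_linear chi) (R_hatK r)
    (V_hatK chi) (W_Delta_Z k) k0).
Qed.
End Recursion.
End Ancestor.

Unset Implicit Arguments.

Theorem corollary1p1 (R : realType) (N : nat) (N_gt0 : (0 < N)%N)
    (alpha : 'I_N -> 'I_2)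
    (Rz r : nat -> 'M[R[i]]_N)
    (r_0 : r 0%N = 0) (Rz_exp : forall n, Rz n = ps_expo r n)
    (DT : 'I_N -> nat -> R[i])
    (DT_0 : forall a, DT a 0%N = 0)
    (DT_1 : forall a, alpha a = 1%N :> nat -> DT a 1%N = 0)
    (Delta sqD : 'I_N -> R[i]) (sqD_Delta : forall a, sqD a ^+ 2 = Delta a)
    (tau : 'I_2 -> nat -> polyring R[i] nat)
    (tauP : forall al : 'I_2, is_tau al (tau al))
    (chi : 'I_N -> nat -> R[i])
    (chiP : forall a n,
       odd_flow (chi a) n = f_series (alpha a) (sqD a) (DT a) n) :
  let Z := ancestor alpha r DT sqD tau in
  let W := cut_and_join alpha r sqD chi in
  [/\ forall n : nat, Z (- n.+1%:Z) = 0,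
      Z 0 = 1
    & forall k : nat, (1 <= k)%N -> Z k%:Z = k%:R^-1 *: W (Z (k.-1)%:Z)].
Proof.
exact: (ancestor_recursion tauP r DT_0 DT_1 chiP).
Qed.
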